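(* Let $D$ be an integral domain, let $x\in D$, and let $\Theta$ be a Jaffard family of $D$. Then $$\mathrm{LPic}(\mathbb{B}_x(D),D)\simeq\bigoplus_{T\in\Theta}\mathrm{LPic}(\mathbb{B}_x(T),T).$$
   Context: $D$ is an integral domain that is not a field, with quotient field $K\neq D$. For a domain $A$ with quotient field $K$ and $x\in A$, the Bhargava ring of $A$ with respect to $x$ is $\mathbb{B}_x(A):=\{f\in K[X]\mid f(xX+a)\in A[X]\text{ for all }a\in A\}$. $\mathrm{Pic}(B)$ is the group of invertible fractional ideals of the domain $B$ modulo nonzero principal fractional ideals. For an extension $A\subseteq B$ of integral domains, the local Picard group is $\mathrm{LPic}(B,A):=\mathrm{Pic}(B)/\iota(\mathrm{Pic}(A))$, where $\iota:\mathrm{Pic}(A)\to\mathrm{Pic}(B)$, $[I]\mapsto[IB]$, is the canonical map. An overring of $D$ is a ring between $D$ and $K$; it is flat if it is flat as a $D$-module. A Jaffard family of $D$ is a family $\Theta$ of flat overrings of $D$ with $K\notin\Theta$ that is complete ($I=\bigcap_{T\in\Theta}IT$ for every ideal $I$ of $D$), independent ($TT'=K$ for all $T\neq T'$ in $\Theta$) and locally finite (every nonzero $x\in D$ is a non-unit in only finitely many $T\in\Theta$). *)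

(* Defs.v *)
From HB Require Import structures.
From mathcomp Require Import all_boot all_order all_algebra generic_quotient.
From mathcomp Require Import ring_quotient.
From mathcomp Require Import all_classical.
From mathcomp.multinomials Require Import freeg.

Set Implicit Arguments.
Unset Strict Implicit.
Unset Printing Implicit Defensive.

Import GRing.Theory.

Local Open Scope classical_set_scope.
Local Open Scope quotient_scope.
Local Open Scope ring_scope.

(* All the integral domains below are subrings of an ambient field, given as
   bundled closed predicates; this lemma shows that equality of bundles is
   equality of the underlying sets. *)
Lemma subringClosed_ext (L : fieldType) (A B : subringClosed L) :
  A =i B -> A = B.
Proof.
case: A => a [[a1] [a2] [a3] [a4]]; case: B => b [[b1] [b2] [b3] [b4]] /= eqab.
have ab : a = b by apply/funext => x; exact: eqab.
subst b; by rewrite (Prop_irrelevance a1 b1) (Prop_irrelevance a2 b2)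
  (Prop_irrelevance a3 b3) (Prop_irrelevance a4 b4).
Qed.

Definition group_isomorphic (U V : zmodType) : Prop :=
  exists f : {additive U -> V}, bijective f.

Section Mulset.
Variable L : fieldType.
Implicit Types (I J N : set L) (A B : subringClosed L).

(* The finite sums of products.  Depending on the arguments, this is the
   product of two fractional ideals, the extension IT of an ideal, or the
   product TT' of two subrings. *)
Definition mulset I J : set L :=
  [set y | exists2 s : seq (L * L),
     forall p, p \in s -> I p.1 /\ J p.2 & y = \sum_(p <- s) p.1 * p.2].

Definition addclosed N : Prop := N 0 /\ forall y z, N y -> N z -> N (y + z).

Lemma mulset_sub I J N : addclosed N ->
  (forall i j, I i -> J j -> N (i * j)) -> mulset I J `<=` N.
Proof.
move=> [N0 ND] IJN _ [s sIJ ->]; rewrite big_seq.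
by elim/big_ind: _ => // p /sIJ[]; apply: IJN.
Qed.

Lemma mulset_mem I J i j : I i -> J j -> mulset I J (i * j).
Proof.
by move=> Ii Jj; exists [:: (i, j)]; [move=> p; rewrite inE => /eqP->|rewrite big_seq1].
Qed.

Lemma mulset_addclosed I J : addclosed (mulset I J).
Proof.
split; first by exists [::]; rewrite ?big_nil.
move=> _ _ [s sP ->] [t tP ->]; exists (s ++ t); last by rewrite big_cat.
by move=> p; rewrite mem_cat => /orP[/sP|/tP].
Qed.

Lemma mulsetC I J : mulset I J = mulset J I.
Proof.
by apply/seteqP; split; apply: mulset_sub => [|i j Ii Jj];
  [exact: mulset_addclosed|rewrite mulrC; exact: mulset_mem..|
   exact: mulset_addclosed|rewrite mulrC; exact: mulset_mem].
Qed.

Lemma addclosed_preim N c : addclosed N -> addclosed [set y | N (y * c)].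
Proof.
by case=> N0 ND; split=> [|y z /= Ny Nz]; rewrite /= ?mul0r// mulrDl; exact: ND.
Qed.

Lemma mulsetA_sub I J N : mulset (mulset I J) N `<=` mulset I (mulset J N).
Proof.
apply: mulset_sub; first exact: mulset_addclosed.
move=> y n yIJ Nn; move: y yIJ.
apply: (@mulset_sub _ _ [set y | mulset I (mulset J N) (y * n)]).
  exact/addclosed_preim/mulset_addclosed.
by move=> i j Ii Jj /=; rewrite -mulrA; do 2!apply: mulset_mem => //.
Qed.

Lemma mulsetA I J N : mulset I (mulset J N) = mulset (mulset I J) N.
Proof.
apply/seteqP; split; last exact: mulsetA_sub.
by rewrite mulsetC (mulsetC J) (mulsetC _ N) (mulsetC I); exact: mulsetA_sub.
Qed.

Definition submodule A I : Prop :=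
  addclosed I /\ forall a y, a \in A -> I y -> I (a * y).

Lemma mulset1 A I : submodule A I -> mulset [set` A] I = I.
Proof.
case=> Iadd IA; apply/seteqP; split; first by apply: mulset_sub.
by move=> y Iy; rewrite -[y]mul1r; apply: mulset_mem => //=; exact: rpred1.
Qed.

Lemma subring_submodule A : submodule A [set` A].
Proof.
by split=> [|a y aA]; [split=> [|y z]; [exact: rpred0|exact: rpredD]|exact: rpredM].
Qed.

Lemma submodule_mulset A I J : submodule A I -> submodule A (mulset I J).
Proof.
move=> [_ IA]; split; first exact: mulset_addclosed.
move=> a y aA; move: y; apply: (@mulset_sub _ _ [set y | mulset I J (a * y)]).
  have [M0 MD] := mulset_addclosed I J.
  by split=> [|y z /= yM zM]; rewrite /= ?mulr0// mulrDr; exact: MD.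
by move=> i j Ii Jj /=; rewrite mulrA; apply: mulset_mem => //; exact: IA.
Qed.

Lemma mulset_subring A B : {subset A <= B} ->
  mulset [set` A] [set` B] = [set` B].
Proof.
move=> sAB; apply: mulset1; have [Badd BM] := subring_submodule B.
by split=> // a y /sAB; exact: BM.
Qed.

(* Since d * I is included in A, such an I is automatically included in the
   quotient field of A, even if the ambient field L is larger. *)
Definition fractional A I : Prop :=
  submodule A I /\
  exists d, [/\ d \in A, d != 0 & forall y, I y -> d * y \in A].

Definition invertible A I : Prop :=
  fractional A I /\ exists2 J, fractional A J & mulset I J = [set` A].

Lemma fractional_subring A : fractional A [set` A].
Proof.
split; first exact: subring_submodule.
by exists 1; split=> [||y /= yA]; rewrite ?rpred1 ?oner_eq0 ?mul1r.
Qed.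

Lemma fractional_mulset A B I J : {subset A <= B} -> fractional A I ->
  fractional B J -> fractional B (mulset I J).
Proof.
move=> sAB [_ [d [dA d0 dI]]] [Jsub [e [eB e0 eJ]]]; split.
  by rewrite mulsetC; exact: submodule_mulset.
exists (d * e); split; [by apply: rpredM => //; exact: sAB|exact: mulf_neq0|].
apply: (@mulset_sub _ _ [set y | d * e * y \in B]).
  by split=> [|y z /= yB zB]; rewrite /= ?mulr0 ?rpred0// mulrDr rpredD.
by move=> i j Ii Jj /=; rewrite mulrACA; apply: rpredM; [exact/sAB/dI|exact: eJ].
Qed.

Lemma invertible_subring A : invertible A [set` A].
Proof.
split; first exact: fractional_subring.
by exists [set` A]; [exact: fractional_subring|exact: mulset_subring].
Qed.

Lemma invertible_ext A B I : {subset A <= B} -> invertible A I ->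
  invertible B (mulset I [set` B]).
Proof.
move=> sAB [If [J Jf IJ]]; have Bf := fractional_subring B.
have BB : mulset [set` B] [set` B] = [set` B] by exact: mulset_subring.
split; first exact: (fractional_mulset sAB).
exists (mulset J [set` B]); first exact: (fractional_mulset sAB).
rewrite mulsetA -(mulsetA I) (mulsetC [set` B]) mulsetA IJ -mulsetA BB.
exact: mulset_subring.
Qed.

Lemma invertible_mulset A I J : invertible A I -> invertible A J ->
  invertible A (mulset I J).
Proof.
move=> [If [I' If' II']] [Jf [J' Jf' JJ']].
have sAA : {subset A <= A} by [].
split; first exact: (fractional_mulset sAA).
exists (mulset I' J'); first exact: (fractional_mulset sAA).
rewrite mulsetA -(mulsetA I) (mulsetC J) mulsetA II' -mulsetA JJ'.
exact: mulset_subring.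
Qed.

Definition invertible_pred A : pred (set L) := fun I => `[< invertible A I >].

Lemma invertible_inverse A I : exists J : set L, invertible A I ->
  invertible A J /\ mulset J I = [set` A].
Proof.
have [[If [J Jf IJ]]|nI] := pselect (invertible A I); last by exists I.
exists J => _; split; last by rewrite mulsetC.
by split=> //; exists I; rewrite // mulsetC.
Qed.

Definition set_inverse A I : set L := projT1 (cid (invertible_inverse A I)).

Lemma set_inverseP A I : invertible A I ->
  invertible A (set_inverse A I) /\ mulset (set_inverse A I) I = [set` A].
Proof. exact: (projT2 (cid (invertible_inverse A I))). Qed.

End Mulset.

(* The group of invertible fractional ideals of A.  The abelian groups of
   this file are zmodType's, hence written additively: the sum of two
   invertible ideals is their product and the zero is A. *)
Record invideal (L : fieldType) (A : subringClosed L) := InvIdeal {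
  invideal_set :> set L;
  _ : invertible_pred A invideal_set }.

HB.instance Definition _ (L : fieldType) (A : subringClosed L) :=
  [isSub for @invideal_set L A].
HB.instance Definition _ (L : fieldType) (A : subringClosed L) :=
  [Choice of invideal A by <:].

Section InvIdealGroup.
Variables (L : fieldType) (A : subringClosed L).
Implicit Types I J : invideal A.

Lemma invidealP I : invertible A I.
Proof. by case: I => I /= /asboolP. Qed.

Definition invideal_of (I : set L) (Iinv : invertible A I) : invideal A :=
  InvIdeal (introT (asboolP _) Iinv).

Definition invideal_one := invideal_of (invertible_subring A).
Definition invideal_mul I J :=
  invideal_of (invertible_mulset (invidealP I) (invidealP J)).
Definition invideal_inv I := invideal_of (set_inverseP (invidealP I)).1.

Lemma invideal_mulA : associative invideal_mul.
Proof. by move=> I J N; apply: val_inj; exact: mulsetA. Qed.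

Lemma invideal_mulC : commutative invideal_mul.
Proof. by move=> I J; apply: val_inj; exact: mulsetC. Qed.

Lemma invideal_mul1 : left_id invideal_one invideal_mul.
Proof.
by move=> I; apply: val_inj; apply: mulset1; have [[]] := invidealP I.
Qed.

Lemma invideal_mulV : left_inverse invideal_one invideal_inv invideal_mul.
Proof. by move=> I; apply: val_inj; exact: (set_inverseP (invidealP I)).2. Qed.

HB.instance Definition _ := GRing.isZmodule.Build (invideal A)
  invideal_mulA invideal_mulC invideal_mul1 invideal_mulV.

Definition principal (I : set L) : Prop :=
  exists2 y, y != 0 & I = [set y * a | a in [set` A]].

Definition principal_invideal : {pred invideal A} :=
  fun I => `[< principal I >].

Lemma principal_invideal_zmod_closed : zmod_closed principal_invideal.
Proof.
split.
  apply/asboolP; exists 1; first exact: oner_neq0.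
  by apply/seteqP; split=> [a aA|_ [a aA <-]]; [exists a|]; rewrite ?mul1r.
move=> I J /asboolP[y y0 IE] /asboolP[z z0 JE]; apply/asboolP.
exists (y / z); first by rewrite mulf_neq0// invr_eq0.
have zA : mulset [set z^-1 * a | a in [set` A]] J = [set` A].
  apply/seteqP; split.
    apply: mulset_sub; first by have [] := subring_submodule A.
    move=> _ j [a aA <-]; rewrite JE => - [b bA <-] /=.
    by rewrite mulrACA mulVf// mul1r; exact: rpredM.
  move=> a aA; rewrite -[a](mulKf z0); apply: mulset_mem.
    by exists 1; rewrite ?mulr1//=; exact: rpred1.
  by rewrite JE; exists a.
have yA : mulset I [set z^-1 * a | a in [set` A]] = [set y / z * a | a in [set` A]].
  apply/seteqP; split.
    apply: mulset_sub.
      split; first by exists 0; rewrite ?mulr0//=; exact: rpred0.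
      move=> _ _ [a aA <-] [b bA <-]; exists (a + b); last by rewrite mulrDr.
      exact: rpredD.
    move=> i j; rewrite IE => - [a aA <-] [b bA <-].
    by exists (a * b); [exact: rpredM|rewrite mulrACA].
  move=> _ [a aA <-]; rewrite -mulrA; apply: mulset_mem; last by exists a.
  by rewrite IE; exists 1; rewrite ?mulr1//=; exact: rpred1.
have IJE : (I : set L) = mulset (I - J : invideal A) J.
  by rewrite -[in LHS](subrK J I).
by rewrite -yA IJE -mulsetA (mulsetC J) zA mulsetC mulset1 //;
  have [[]] := invidealP (I - J).
Qed.

HB.instance Definition _ := GRing.isZmodClosed.Build (invideal A)
  principal_invideal principal_invideal_zmod_closed.

Definition Pic : zmodType :=
  Quotient.quot (principal_invideal : zmodClosed (invideal A)).

End InvIdealGroup.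

Section LocalPic.
Variables (L : fieldType) (B A : subringClosed L) (sAB : {subset A <= B}).

Definition ext_invideal (I : invideal A) : invideal B :=
  invideal_of (invertible_ext sAB (invidealP I)).

Lemma ext_invideal_is_zmod_morphism : zmod_morphism ext_invideal.
Proof.
have extD I J : ext_invideal (I + J) = ext_invideal I + ext_invideal J.
  apply: val_inj; rewrite /= -[LHS]/(mulset (mulset I J) [set` B]).
  rewrite -[RHS]/(mulset (mulset I [set` B]) (mulset J [set` B])).
  rewrite [RHS]mulsetA -(mulsetA I [set` B]) (mulsetC [set` B]) mulsetA.
  by rewrite -[RHS]mulsetA mulset_subring.
by move=> I J; apply/eqP; rewrite eq_sym subr_eq -extD subrK.
Qed.

HB.instance Definition _ := GRing.isZmodMorphism.Build _ _ ext_invideal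
  ext_invideal_is_zmod_morphism.

Definition Pic_ext (c : Pic A) : Pic B := \pi_(Pic B) (ext_invideal (repr c)).

Lemma Pic_extE (I : invideal A) :
  Pic_ext (\pi_(Pic A) I) = \pi_(Pic B) (ext_invideal I).
Proof.
apply/eqP; rewrite -Quotient.idealrBE -raddfB.
have : repr (\pi_(Pic A) I) - I \in @principal_invideal L A.
  by rewrite Quotient.idealrBE reprK.
move: (_ - I) => J /asboolP[y y0 JE]; apply/asboolP; exists y => //=.
rewrite JE; apply/seteqP; split.
  apply: mulset_sub.
    split; first by exists 0; rewrite ?mulr0//=; exact: rpred0.
    move=> _ _ [a aA <-] [b bA <-]; exists (a + b); last by rewrite mulrDr.
    exact: rpredD.
  move=> _ b [a aA <-] bB; exists (a * b); last by rewrite mulrA.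
  by apply: rpredM => //; exact: sAB.
move=> _ [b bB <-]; apply: mulset_mem => //; exists 1; rewrite ?mulr1//=.
exact: rpred1.
Qed.

Lemma Pic_ext_is_zmod_morphism : zmod_morphism Pic_ext.
Proof.
elim/quotW=> I; elim/quotW=> J.
by rewrite -raddfB !Pic_extE !raddfB.
Qed.

HB.instance Definition _ := GRing.isZmodMorphism.Build _ _ Pic_ext
  Pic_ext_is_zmod_morphism.

Definition Pic_ext_range : {pred Pic B} := fun c => `[< range Pic_ext c >].

Lemma Pic_ext_range_zmod_closed : zmod_closed Pic_ext_range.
Proof.
split; first by apply/asboolP; exists 0; rewrite ?raddf0.
move=> _ _ /asboolP[c _ <-] /asboolP[e _ <-].
by apply/asboolP; exists (c - e); rewrite ?raddfB.
Qed.

HB.instance Definition _ := GRing.isZmodClosed.Build (Pic B) Pic_ext_range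
  Pic_ext_range_zmod_closed.

Definition LPic : zmodType :=
  Quotient.quot (Pic_ext_range : zmodClosed (Pic B)).

End LocalPic.

Definition bhargava_pred (K : fieldType) (A : subringClosed K) (x : K) :
    {pred {poly K}} :=
  fun f => `[< forall a, a \in A -> f \Po (x *: 'X + a%:P) \is a polyOver A >].

Section Bhargava.
Variables (K : fieldType) (A : subringClosed K) (x : K).

Lemma bhargava_subring_closed : subring_closed (bhargava_pred A x).
Proof.
split=> [|f g /asboolP fP /asboolP gP|f g /asboolP fP /asboolP gP];
  apply/asboolP => a aA.
- by rewrite comp_polyC rpred1.
- by rewrite comp_polyB rpredB ?fP ?gP.
- by rewrite comp_polyM rpredM ?fP ?gP.
Qed.

HB.instance Definition _ := GRing.isSubringClosed.Build {poly K}
  (bhargava_pred A x) bhargava_subring_closed.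

Definition bhargava : subringClosed {poly K} := bhargava_pred A x.

End Bhargava.

Definition image_pred (R : nzRingType) (L : fieldType)
    (phi : {rmorphism R -> L}) (A : subringClosed R) : {pred L} :=
  fun y => `[< exists2 a, a \in A & phi a = y >].

Section ImageRing.
Variables (R : nzRingType) (L : fieldType) (phi : {rmorphism R -> L}).
Variable A : subringClosed R.

Lemma image_subring_closed : subring_closed (image_pred phi A).
Proof.
split=> [|_ _ /asboolP[a aA <-] /asboolP[b bA <-]|
         _ _ /asboolP[a aA <-] /asboolP[b bA <-]]; apply/asboolP.
- by exists 1; rewrite ?rpred1 ?rmorph1.
- by exists (a - b); rewrite ?rpredB ?rmorphB.
- by exists (a * b); rewrite ?rpredM ?rmorphM.
Qed.

HB.instance Definition _ := GRing.isSubringClosed.Build L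
  (image_pred phi A) image_subring_closed.

Definition image_subring : subringClosed L := image_pred phi A.

End ImageRing.

(* LPic requires both rings in one field: A and its Bhargava ring are moved to
   the field K(X) of rational functions, the quotient field of the latter. *)
Definition const_in (K : fieldType) (A : subringClosed K) :
    subringClosed {fraction {poly K}} :=
  image_subring (@tofrac {poly K} \o polyC) A.

Definition bhargava_in (K : fieldType) (A : subringClosed K) (x : K) :
    subringClosed {fraction {poly K}} :=
  image_subring (@tofrac {poly K}) (bhargava A x).

Lemma const_bhargava (K : fieldType) (A : subringClosed K) (x : K) :
  {subset const_in A <= bhargava_in A x}.
Proof.
move=> _ /asboolP[a aA <-]; apply/asboolP; exists a%:P => //.
by apply/asboolP => b bA; rewrite comp_polyC polyOverC.
Qed.

Definition LPic_bhargava (K : fieldType) (A : subringClosed K) (x : K) :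
    zmodType :=
  LPic (@const_bhargava K A x).

(* The submodule of bilinearity relations, by which the tensor product is a
   quotient of the free R-module on M * N. *)
Inductive tensor_rel (R : comNzRingType) (M N : lmodType R) :
    {freeg (M * N) / R} -> Prop :=
| tensor_rel0 : tensor_rel 0
| tensor_relD u v of tensor_rel u & tensor_rel v : tensor_rel (u + v)
| tensor_relZ a u of tensor_rel u : tensor_rel (a *: u)
| tensor_rel_addl m m' n :
    tensor_rel (<< (m + m', n) >> - << (m, n) >> - << (m', n) >>)
| tensor_rel_addr m n n' :
    tensor_rel (<< (m, n + n') >> - << (m, n) >> - << (m, n') >>)
| tensor_rel_scalel a m n :
    tensor_rel (<< (a *: m, n) >> - a *: << (m, n) >>)
| tensor_rel_scaler a m n :
    tensor_rel (<< (m, a *: n) >> - a *: << (m, n) >>).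

Section Tensor.
Variable R : comNzRingType.

Definition tensor_pred (M N : lmodType R) : {pred {freeg (M * N) / R}} :=
  fun u => `[< tensor_rel u >].

Lemma tensor_pred_zmod_closed (M N : lmodType R) :
  zmod_closed (@tensor_pred M N).
Proof.
split; first by apply/asboolP; exact: tensor_rel0.
move=> u v /asboolP uP /asboolP vP; apply/asboolP.
by rewrite -scaleN1r; apply: tensor_relD => //; exact: tensor_relZ.
Qed.

HB.instance Definition _ (M N : lmodType R) := GRing.isZmodClosed.Build
  {freeg (M * N) / R} (@tensor_pred M N) (@tensor_pred_zmod_closed M N).

Definition tensor (M N : lmodType R) : zmodType :=
  Quotient.quot (@tensor_pred M N : zmodClosed {freeg (M * N) / R}).

Variables (M M' N : lmodType R) (f : {linear M -> M'}).

Definition free_map (u : {freeg (M * N) / R}) : {freeg (M' * N) / R} :=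
  fglift (fun p => << (f p.1, p.2) >>) u.

Definition tensor_map (t : tensor M N) : tensor M' N :=
  \pi_(tensor M' N) (free_map (repr t)).

Lemma free_map_is_zmod_morphism : zmod_morphism free_map.
Proof. exact: lift_is_additive. Qed.

HB.instance Definition _ := GRing.isZmodMorphism.Build _ _ free_map
  free_map_is_zmod_morphism.

Lemma free_map_is_scalable : scalable free_map.
Proof.
move=> a u; rewrite -[in RHS](freeg_sumE u).
rewrite -[X in free_map X]/(fgscale a u) !raddf_sum /=.
by apply: eq_bigr => p _; rewrite /free_map !liftU scalerA.
Qed.

HB.instance Definition _ := GRing.isScalable.Build R _ _ *:%R free_map
  free_map_is_scalable.

Lemma free_mapB u v : free_map (u - v) = free_map u - free_map v.
Proof. exact: raddfB. Qed.

Lemma free_mapZ a u : free_map (a *: u) = a *: free_map u.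
Proof. exact: linearZ. Qed.

Lemma free_mapU p : free_map << p >> = << (f p.1, p.2) >>.
Proof. by rewrite /free_map liftU scale1r. Qed.

Lemma free_map_rel u : tensor_rel u -> tensor_rel (free_map u).
Proof.
elim=> [|{}u v _ IHu _ IHv|a {}u _ IHu|m m' n|m n n'|a m n|a m n].
- by rewrite raddf0; exact: tensor_rel0.
- by rewrite raddfD; exact: tensor_relD.
- by rewrite linearZ; exact: tensor_relZ.
- by rewrite !free_mapB !free_mapU /= raddfD; exact: tensor_rel_addl.
- by rewrite !free_mapB !free_mapU /=; exact: tensor_rel_addr.
- by rewrite free_mapB free_mapZ !free_mapU /= linearZ; exact: tensor_rel_scalel.
- by rewrite free_mapB free_mapZ !free_mapU /=; exact: tensor_rel_scaler.
Qed.

Lemma tensor_mapE u :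
  tensor_map (\pi_(tensor M N) u) = \pi_(tensor M' N) (free_map u).
Proof.
apply/eqP; rewrite -Quotient.idealrBE -raddfB.
have : repr (\pi_(tensor M N) u) - u \in @tensor_pred M N.
  by rewrite Quotient.idealrBE reprK.
by move=> /asboolP uP; apply/asboolP; exact: free_map_rel.
Qed.

End Tensor.

Definition flat (R : comNzRingType) (N : lmodType R) : Prop :=
  forall (M M' : lmodType R) (f : {linear M -> M'}),
    injective f -> injective (tensor_map (N := N) f).

Record subring_type (K : fieldType) (D : subringClosed K) := SubringType {
  subring_val :> K;
  _ : subring_val \in D }.

HB.instance Definition _ (K : fieldType) (D : subringClosed K) :=
  [isSub for @subring_val K D].
HB.instance Definition _ (K : fieldType) (D : subringClosed K) :=
  [Choice of subring_type D by <:].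
HB.instance Definition _ (K : fieldType) (D : subringClosed K) :=
  [SubChoice_isSubComNzRing of subring_type D by <:].

Definition overring_module (K : fieldType) (D T : subringClosed K)
  (sDT : {subset D <= T}) : Type := subring_type T.

Section OverringModule.
Variables (K : fieldType) (D T : subringClosed K) (sDT : {subset D <= T}).

HB.instance Definition _ := GRing.Zmodule.on (overring_module sDT).

Lemma overring_scale_subproof (d : subring_type D) (t : overring_module sDT) :
  val d * val (t : subring_type T) \in T.
Proof. by apply: rpredM; [exact: sDT (valP d)|exact: valP]. Qed.

Definition overring_scale (d : subring_type D) (t : overring_module sDT) :
  overring_module sDT := SubringType (overring_scale_subproof d t).

Lemma overring_scaleA a b t :
  overring_scale a (overring_scale b t) = overring_scale (a * b) t.
Proof. by apply: val_inj => /=; rewrite mulrA. Qed.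

Lemma overring_scale1 : left_id 1 overring_scale.
Proof. by move=> t; apply: val_inj => /=; rewrite mul1r. Qed.

Lemma overring_scaleDr : right_distributive overring_scale +%R.
Proof. by move=> a t u; apply: val_inj => /=; rewrite mulrDr. Qed.

Lemma overring_scaleDl t : {morph overring_scale^~ t : a b / a + b}.
Proof. by move=> a b; apply: val_inj => /=; rewrite mulrDl. Qed.

HB.instance Definition _ := GRing.Zmodule_isLmodule.Build (subring_type D)
  (overring_module sDT)
  overring_scaleA overring_scale1 overring_scaleDr overring_scaleDl.

End OverringModule.

Section Jaffard.
Variables (K : fieldType) (D : subringClosed K).

Definition is_quotient_field : Prop :=
  forall y : K, exists a b, [/\ a \in D, b \in D, b != 0 & y = a / b].

Definition flat_overring (T : subringClosed K) : Prop :=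
  exists sDT : {subset D <= T}, flat (overring_module sDT).

Definition is_ideal (I : set K) : Prop := submodule D I /\ I `<=` [set` D].

Definition is_unit (T : subringClosed K) (y : K) : Prop :=
  y \in T /\ exists2 z, z \in T & y * z = 1.

Record jaffard_family (Theta : set (subringClosed K)) : Prop := {
  jaffard_flat : forall T, Theta T -> flat_overring T;
  jaffard_proper : forall T, Theta T -> [set` T] != setT;
  jaffard_complete : forall I, is_ideal I ->
    I = \bigcap_(T in Theta) mulset I [set` T];
  jaffard_independent : forall T T', Theta T -> Theta T' -> T <> T' ->
    mulset [set` T] [set` T'] = setT;
  jaffard_locally_finite : forall y, y \in D -> y != 0 ->
    finite_set [set T | Theta T /\ ~ is_unit T y] }.

End Jaffard.

Definition direct_prod (I : Type) (M : I -> zmodType) : Type := forall i, M i.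

Section DirectSum.
Variables (I : Type) (M : I -> zmodType).
Implicit Types f g : direct_prod M.

HB.instance Definition _ := Choice.copy (direct_prod M) (forall i, M i).

Definition direct_prod_zero : direct_prod M := fun i => 0.
Definition direct_prod_add f g : direct_prod M := fun i => f i + g i.
Definition direct_prod_opp f : direct_prod M := fun i => - f i.

Lemma direct_prod_addA : associative direct_prod_add.
Proof. by move=> f g h; apply: functional_extensionality_dep => i; exact: addrA. Qed.

Lemma direct_prod_addC : commutative direct_prod_add.
Proof. by move=> f g; apply: functional_extensionality_dep => i; exact: addrC. Qed.

Lemma direct_prod_add0 : left_id direct_prod_zero direct_prod_add.
Proof. by move=> f; apply: functional_extensionality_dep => i; exact: add0r. Qed.

Lemma direct_prod_addN :
  left_inverse direct_prod_zero direct_prod_opp direct_prod_add.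
Proof. by move=> f; apply: functional_extensionality_dep => i; exact: addNr. Qed.

HB.instance Definition _ := GRing.isZmodule.Build (direct_prod M)
  direct_prod_addA direct_prod_addC direct_prod_add0 direct_prod_addN.

Definition finsupp_pred : {pred direct_prod M} :=
  fun f => `[< finite_set [set i | f i <> 0] >].

Lemma finsupp_zmod_closed : zmod_closed finsupp_pred.
Proof.
split=> [|f g /asboolP ffin /asboolP gfin]; apply/asboolP.
  by apply: sub_finite_set (finite_set0 I) => i /=.
have fgfin : finite_set ([set i | f i <> 0] `|` [set i | g i <> 0]).
  by rewrite finite_setU.
apply: sub_finite_set fgfin => i /= fgi.
have [fi0|] := pselect (f i = 0); last by left.
right=> gi0; apply: fgi; rewrite -[LHS]/(f i - g i) fi0 gi0.
exact: subrr.
Qed.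

HB.instance Definition _ := GRing.isZmodClosed.Build (direct_prod M)
  finsupp_pred finsupp_zmod_closed.

Record direct_sum := DirectSum {
  direct_sum_val :> direct_prod M;
  _ : direct_sum_val \in finsupp_pred }.

HB.instance Definition _ := [isSub for direct_sum_val].
HB.instance Definition _ := [Choice of direct_sum by <:].
HB.instance Definition _ := [SubChoice_isSubZmodule of direct_sum by <:].

End DirectSum.

(* Main.v *)
(* For an overring [T] in the Jaffard family, call an ideal [c] of [D] spanning
   at [T] when [cT = T].  Flatness makes every conductor [(D : t)], [t] in [T],
   spanning; independence and local finiteness make the ideal of all [c] in [D]
   that are multiples of [d] in every [T' <> T] spanning at [T]; completeness
   says that an ideal spanning at all [T] is [D].  Hence [B_x(T)] is the
   localization of [B_x(D)] at [T]: [I B_x(T)] consists of the [y] for which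
   [(I : y)] is spanning at [T].

   As [K[X]] is principal, each class of [Pic(B_x(D))] has a representative [I]
   such that [I] and [I^-1] consist of polynomials; both then contain a common
   nonzero constant [d], so [I B_x(T) = B_x(T)] whenever [d] is a unit of [T].
   If all [I B_x(T)] are trivial in the local Picard groups, [I] is extended
   from [I :&: K], whose inverse is [I^-1 :&: K].  Conversely, given such
   representatives [I_T], almost all trivial, their intersection is invertible,
   with inverse the intersection of the [I_T^-1], and localizes to each [I_T]. *)

Require Import Defs.
From HB Require Import structures.
From mathcomp Require Import all_boot all_order all_algebra.
From mathcomp Require Import generic_quotient ring_quotient.
From mathcomp Require Import all_classical.
From mathcomp.multinomials Require Import freeg.

Set Implicit Arguments.
Unset Strict Implicit.
Unset Printing Implicit Defensive.

Import GRing.Theory.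

Local Open Scope classical_set_scope.
Local Open Scope quotient_scope.
Local Open Scope ring_scope.

(** * Flat overrings *)

Section TwoGenerated.
Variables (R : comNzRingType) (a b : R).

(** The ideal [aR + bR], made a module of its own so that its inclusion in [R^o] is an injective
    linear map to which flatness applies. *)
Definition span2_pred : {pred R^o} :=
  fun m => `[< exists p : R * R, m = p.1 * a + p.2 * b >].

Lemma span2_submod_closed : submod_closed span2_pred.
Proof.
split; first by apply/asboolP; exists (0, 0); rewrite /= !mul0r addr0.
move=> c _ _ /asboolP[p ->] /asboolP[q ->]; apply/asboolP.
exists (c * p.1 + q.1, c * p.2 + q.2) => /=.
by rewrite !mulrDl addrACA -!mulrA -mulrDr.
Qed.

HB.instance Definition _ := GRing.isSubmodClosed.Build R R^o
  span2_pred span2_submod_closed.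

Record span2 := Span2 { span2_val :> R^o; _ : span2_val \in span2_pred }.

HB.instance Definition _ := [isSub for span2_val].
HB.instance Definition _ := [Choice of span2 by <:].
HB.instance Definition _ := [SubChoice_isSubLmodule of span2 by <:].

Lemma span2P (m : span2) :
  exists p : R * R, (val m : R) = p.1 * a + p.2 * b.
Proof. by case: m => m /= /asboolP. Qed.

Definition span2_coord (m : span2) : R := (projT1 (cid (span2P m))).1.

Lemma span2_coordP (m : span2) :
  exists c, (val m : R) = span2_coord m * a + c * b.
Proof.
by rewrite /span2_coord; case: cid => p /= ->; exists p.2.
Qed.

Lemma span2_genl : a \in span2_pred.
Proof. by apply/asboolP; exists (1, 0); rewrite /= mul1r mul0r addr0. Qed.

Lemma span2_genr : b \in span2_pred.
Proof. by apply/asboolP; exists (0, 1); rewrite /= mul1r mul0r add0r. Qed.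

End TwoGenerated.

Lemma quot_pi0 (V : zmodType) (S : zmodClosed V) (u : V) :
  (\pi_(Quotient.quot S) u == 0) = (u \in S).
Proof.
have := Quotient.idealrBE S u 0.
by rewrite subr0 raddf0 => ->.
Qed.

Lemma tensor_pi0 (R : comNzRingType) (M N : lmodType R)
    (u : {freeg (M * N) / R}) :
  \pi_(tensor M N) u = 0 <-> tensor_rel u.
Proof.
have e := quot_pi0 (@tensor_pred R M N : zmodClosed _) u.
by split=> [/eqP|urel]; [rewrite e => /asboolP|apply/eqP; rewrite e; apply/asboolP].
Qed.

Lemma tensor_relB (R : comNzRingType) (M N : lmodType R)
    (u v : {freeg (M * N) / R}) :
  tensor_rel u -> tensor_rel v -> tensor_rel (u - v).
Proof.
by move=> ur vr; rewrite -scaleN1r; apply: tensor_relD => //; exact: tensor_relZ.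
Qed.

Lemma tensor_rel_regular (R : comNzRingType) (N : lmodType R) (a : R) (n : N) :
  tensor_rel (<< (a : R^o, n) >> - << (1, a *: n) >> : {freeg (R^o * N) / R}).
Proof.
have /(_ a 1 n) l := @tensor_rel_scalel R R^o N.
have /(_ a 1 n) r := @tensor_rel_scaler R R^o N.
have := tensor_relB l r; rewrite opprB addrA subrK.
by have -> : a *: (1 : R^o) = a by exact: mulr1.
Qed.

Section FlatOverring.
Variables (K : fieldType) (D T : subringClosed K) (sDT : {subset D <= T}).

Lemma val_overring_scale (d : subring_type D) (t : overring_module sDT) :
  val (d *: t : overring_module sDT) = val d * val t :> K.
Proof. by []. Qed.

Variables (a b : subring_type D) (t : subring_type T).
Hypotheses (b0 : val b != 0) (tE : val t = val a / val b).

Let conductor : set K := [set c | c \in D /\ c * val t \in D].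
Let M := span2 a b.
Let N := overring_module sDT.

(* The coefficient of [a] is chosen, and only well defined modulo the conductor
   [(D : t)], so [lift_coord] is bilinear only modulo [(D : t)T]. *)
Definition lift_coord (u : {freeg (M * N) / subring_type D}) : N :=
  fglift (fun p => span2_coord p.1 *: p.2) u.

Lemma lift_coord_is_zmod_morphism : zmod_morphism lift_coord.
Proof. exact: lift_is_additive. Qed.

HB.instance Definition _ := GRing.isZmodMorphism.Build _ _ lift_coord
  lift_coord_is_zmod_morphism.

(** Since [t = a / b], the syzygy [c a = d b] says that [c t = d]. *)
Lemma in_conductor (c d : subring_type D) :
  c * a = d * b -> conductor (val c).
Proof.
move=> /(congr1 val) /= cE; split; first exact: valP.
by rewrite tE mulrA cE mulfK//; exact: valP.
Qed.

Lemma lift_coordB u v : lift_coord (u - v) = lift_coord u - lift_coord v.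
Proof. exact: raddfB. Qed.

Lemma lift_coordU m n : lift_coord << (m, n) >> = span2_coord m *: n.
Proof. by rewrite /lift_coord liftU scale1r. Qed.

Lemma lift_coordZ c u : lift_coord (c *: u) = c *: lift_coord u.
Proof.
rewrite -[in RHS](freeg_sumE u) -[X in lift_coord X]/(fgscale c u).
rewrite !raddf_sum /=.
by apply: eq_bigr => p _; rewrite /lift_coord !liftU !scalerA.
Qed.

(** Two expressions of one element through [a] and [b] differ by a syzygy, so their coefficients of
    [a] agree modulo the conductor. *)
Lemma conductor_mod (c d e e' : subring_type D) (s : N) :
  c * a + e * b = d * a + e' * b ->
  mulset conductor [set` T] (val (c *: s - d *: s : N)).
Proof.
move=> cd; have /in_conductor ce : (c - d) * a = (e' - e) * b.
  by apply/eqP; rewrite !mulrBl subr_eq addrAC eq_sym subr_eq cd addrC.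
by rewrite -scalerBl; apply: mulset_mem => //; exact: valP.
Qed.

(** This yields a map from [(aD + bD) (x) T] to [T / (D : t)T]. Relations in the second factor are
    respected exactly, those in the first only through [conductor_mod]. *)
Lemma lift_coord_rel u : tensor_rel u ->
  mulset conductor [set` T] (val (lift_coord u)).
Proof.
have [C0 CD] : addclosed (mulset conductor [set` T]) by exact: mulset_addclosed.
elim=> [|{}u v _ IHu _ IHv|c {}u _ IHu|m m' n|m n n'|c m n|c m n].
- by rewrite raddf0.
- by rewrite raddfD; exact: CD.
- rewrite lift_coordZ val_overring_scale mulrC.
  move: IHu; move: (val (lift_coord u)) => y [s sP ->].
  exists [seq (p.1, p.2 * val c) | p <- s] => [p|].
    move=> /mapP[q /sP[Cq Tq] ->]; split=> //=.
    by apply: rpredM => //; apply: sDT; exact: valP.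
  by rewrite big_map mulr_suml; apply: eq_bigr => p _; rewrite mulrA.
- rewrite !lift_coordB !lift_coordU -addrA -opprD -scalerDl.
  have [e1 h1] := span2_coordP (m + m'); have [e2 h2] := span2_coordP m.
  have [e3 h3] := span2_coordP m'; apply: (conductor_mod (e := e1) (e' := e2 + e3)).
  rewrite -h1.
  have -> : val (m + m') = (val m : subring_type D) + val m' :> subring_type D by [].
  by rewrite h2 h3 !mulrDl addrACA.
- rewrite !lift_coordB !lift_coordU scalerDr.
  by rewrite -addrA -opprD subrr.
- rewrite lift_coordB lift_coordZ !lift_coordU scalerA.
  have [e1 h1] := span2_coordP (c *: m); have [e2 h2] := span2_coordP m.
  apply: (conductor_mod (e := e1) (e' := c * e2)).
  rewrite -h1.
  have -> : val (c *: m) = c * (val m : subring_type D) :> subring_type D by [].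
  by rewrite h2; apply: etrans (mulrDr _ _ _) _; congr (_ + _); exact: mulrA.
- rewrite lift_coordB lift_coordZ !lift_coordU scalerA scalerA (mulrC c).
  by rewrite subrr.
Qed.

End FlatOverring.

(** By flatness [a (x) 1 = b (x) t] holds already in [(aD + bD) (x) T]; taking coefficients of [a]
    turns this into [1 = 0] modulo [(D : t)T]. *)
Lemma flat_conductor (K : fieldType) (D T : subringClosed K) (t : K) :
  is_quotient_field D -> flat_overring D T -> t \in T ->
  mulset [set c | c \in D /\ c * t \in D] [set` T] 1.
Proof.
move=> quoK [sDT flatT] tT.
have [a0 [b0 [aD bD b_neq0 tE]]] := quoK t.
pose a := SubringType aD : subring_type D; pose b := SubringType bD : subring_type D.
pose t' := SubringType tT : subring_type T.
pose N := overring_module sDT.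
pose ga : span2 a b := Span2 (span2_genl a b).
pose gb : span2 a b := Span2 (span2_genr a b).
pose f : {linear span2 a b -> (subring_type D)^o} := \val.
have /flatT inj : injective f by exact: val_inj.
(* [a (x) 1 - b (x) t] vanishes in [D (x) T], hence in [(aD + bD) (x) T] *)
pose u : {freeg (span2 a b * N) / subring_type D} :=
  << (ga, 1 : N) >> - << (gb, t' : N) >>.
have /lift_coord_rel : tensor_rel u.
  apply/tensor_pi0/inj; rewrite tensor_mapE.
  rewrite -[X in tensor_map _ X](raddf0 (\pi_(tensor _ _))).
  rewrite tensor_mapE raddf0 raddf0.
  apply/tensor_pi0.
  rewrite /u free_mapB !free_mapU /=.
  have ab : a *: (1 : N) = b *: (t' : N).
    by apply: val_inj; rewrite /= mulr1 tE mulrC divfK.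
  have := tensor_relB (tensor_rel_regular a (1 : N)) (tensor_rel_regular b (t' : N)).
  by rewrite ab opprB addrA subrK.
move=> /(_ t' b_neq0 tE); rewrite /u lift_coordB !lift_coordU.
rewrite -[mulset _ _ (val _)]/(mulset [set c | c \in D /\ c * t \in D] [set` T]
  (val (span2_coord ga) * 1 - val (span2_coord gb) * t)).
have [_ MD] := mulset_addclosed [set c | c \in D /\ c * t \in D] [set` T].
have [e1 h1] := span2_coordP ga; have [e2 h2] := span2_coordP gb.
have in_cond := @in_conductor K D T a b t' b_neq0 tE.
(* Modulo the conductor, the chosen coefficient of [a] is [1] for [ga] and [0] for [gb]. *)
have /in_cond gaC : (1 - span2_coord ga) * a = e1 * b.
  by rewrite mulrBl mul1r [X in X - _ = _](h1 : a = _) addrC addKr.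
have /in_cond gbC : span2_coord gb * a = (1 - e2) * b.
  by rewrite mulrBl mul1r [X in _ = X - _](h2 : b = _) addrK.
move=> /MD /(_ (mulset_mem (J := [set` T]) gaC (rpred1 T))).
move=> /MD /(_ (mulset_mem (J := [set` T]) gbC tT)).
by rewrite addrAC subrK !mulr1 addrC subrK.
Qed.

Lemma mulset_mono (L : fieldType) (I I' J J' : set L) :
  I `<=` I' -> J `<=` J' -> mulset I J `<=` mulset I' J'.
Proof.
move=> sI sJ; apply: mulset_sub; first exact: mulset_addclosed.
by move=> i j /sI Ii /sJ Jj; exact: mulset_mem.
Qed.

(** * Spanning ideals *)

Section Spanning.
Variables (K : fieldType) (D T : subringClosed K) (sDT : {subset D <= T}).
Implicit Types c e : set K.

Definition spanning c : Prop := is_ideal D c /\ mulset c [set` T] 1.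

Lemma spanning_sup c e : is_ideal D e -> c `<=` e -> spanning c -> spanning e.
Proof. by move=> eD ce [_ c1]; split=> //; exact: mulset_mono c1. Qed.

Lemma spanning_subring : spanning [set` D].
Proof.
split; first by split=> //; exact: subring_submodule.
by rewrite mulset_subring //=; exact: rpred1.
Qed.

Lemma ideal_mulset c e : is_ideal D c -> is_ideal D e -> is_ideal D (mulset c e).
Proof.
move=> [cD sc] [eD se]; split; first exact: submodule_mulset.
apply: mulset_sub; first by have [] := subring_submodule D.
by move=> i j /sc iD /se jD; exact: rpredM.
Qed.

Lemma spanning_mulset c e : spanning c -> spanning e -> spanning (mulset c e).
Proof.
move=> [cD c1] [eD e1]; split; first exact: ideal_mulset.
have : mulset (mulset c [set` T]) (mulset e [set` T]) (1 * 1) by exact: mulset_mem.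
rewrite mulr1 mulsetA -(mulsetA c) (mulsetC [set` T]) mulsetA -(mulsetA _ [set` T]).
by rewrite (mulset_subring (A := T)).
Qed.

Lemma idealI c e : is_ideal D c -> is_ideal D e -> is_ideal D (c `&` e).
Proof.
move=> [[[c0 cD] cM] sc] [[[e0 eD] eM] se]; split; last by move=> y [/sc].
split; first by split=> // y z [cy ey] [cz ez]; split; [exact: cD|exact: eD].
by move=> a y aD [cy ey]; split; [exact: cM|exact: eM].
Qed.

Lemma spanningI c e : spanning c -> spanning e -> spanning (c `&` e).
Proof.
move=> cs es; have [[[[c0 cD] cM] sc] _] := cs.
have [[[[e0 eD] eM] se] _] := es.
apply: (spanning_sup _ _ (spanning_mulset cs es)).
  by apply: idealI; [case: cs|case: es].
move=> y ycm; split; move: y ycm; apply: mulset_sub => // i j ci ej.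
  by rewrite mulrC; apply: cM => //; exact: se.
by apply: eM => //; exact: sc.
Qed.

Lemma ideal_all (X : Type) (P : X -> Prop) (c : X -> set K) :
  (forall p, P p -> is_ideal D (c p)) ->
  is_ideal D [set y | y \in D /\ forall p, P p -> c p y].
Proof.
move=> cI; split; last by move=> y [].
split; first split.
- by split=> [|p /cI[[[]]]//]; exact: rpred0.
- move=> y z [yD cy] [zD cz]; split; first exact: rpredD.
  by move=> p Pp; have [[[_ cD] _] _] := cI p Pp; exact: cD (cy p Pp) (cz p Pp).
- move=> a y aD [yD cy]; split; first exact: rpredM.
  by move=> p Pp; have [[_ cM] _] := cI p Pp; exact: cM (cy p Pp).
Qed.

(** The clause [y \in D] makes the empty intersection equal to [D], where the induction starts. *)
Lemma spanning_all (X : eqType) (s : seq X) (c : X -> set K) :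
  (forall p, p \in s -> spanning (c p)) ->
  spanning [set y | y \in D /\ forall p, p \in s -> c p y].
Proof.
elim: s => [_|p s IHs cs].
  suff -> : [set y | y \in D /\ forall p, p \in [::] -> c p y] = [set` D].
    exact: spanning_subring.
  by apply/seteqP; split=> [y []|y yD]//; split.
suff -> : [set y | y \in D /\ forall q, q \in p :: s -> c q y] =
  c p `&` [set y | y \in D /\ forall q, q \in s -> c q y].
  apply: spanningI; first by apply: cs; rewrite inE eqxx.
  by apply: IHs => q qs; apply: cs; rewrite inE qs orbT.
apply/seteqP; split=> y.
  move=> [yD cy]; split; first by apply: cy; rewrite inE eqxx.
  by split=> // q qs; apply: cy; rewrite inE qs orbT.
move=> [cpy [yD cy]]; split=> // q; rewrite inE => /orP[/eqP->//|].
exact: cy.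
Qed.

End Spanning.

(** * Conductor ideals of elements of a larger field *)

Section Residual.
Variables (K L : fieldType) (phi : {rmorphism K -> L}) (D : subringClosed K).
Implicit Types M N : set L.

(** The ideal [(M : y)] of [D]. The map [phi] lets [M] and [y] live in a larger field, later [K(X)],
    while the ideal stays in [K]. *)
Definition residual M (y : L) : set K := [set c | c \in D /\ M (phi c * y)].

Lemma mem_image_subring c : c \in D -> phi c \in image_subring phi D.
Proof. by move=> cD; apply/asboolP; exists c. Qed.

Lemma residual_ideal M y :
  submodule (image_subring phi D) M -> is_ideal D (residual M y).
Proof.
move=> [[M0 MD] MM]; split; last by move=> c [].
split.
  split; first by split; rewrite ?rpred0// rmorph0 mul0r.
  move=> c e [cD cy] [eD ey]; split; first exact: rpredD.
  by rewrite rmorphD mulrDl; exact: MD.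
move=> a c aD [cD cy]; split; first exact: rpredM.
by rewrite rmorphM -mulrA; apply: MM => //; exact: mem_image_subring.
Qed.

Lemma residual1 M y : residual M y 1 -> M y.
Proof. by move=> [_]; rewrite rmorph1 mul1r. Qed.

End Residual.

(** * Spanning ideals and approximation in a Jaffard family *)

Section JaffardFamily.
Variables (K : fieldType) (D : subringClosed K).
Hypothesis quoK : is_quotient_field D.
Variable Theta : set (subringClosed K).
Hypothesis jaffard : jaffard_family D Theta.
Implicit Types T : subringClosed K.

Lemma jaffard_sub T : Theta T -> {subset D <= T}.
Proof. by move=> /(jaffard_flat jaffard)[]. Qed.

Lemma spanning_one c : is_ideal D c ->
  (forall T, Theta T -> spanning D T c) -> c 1.
Proof.
move=> cD cs; rewrite (jaffard_complete jaffard cD) => T /cs[_].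
exact.
Qed.

Lemma jaffard_bigcap y : (forall T, Theta T -> y \in T) -> y \in D.
Proof.
move=> yT; have Did : is_ideal D [set` D] by split=> //; exact: subring_submodule.
suff: [set` D] y by [].
rewrite (jaffard_complete jaffard Did) => T TT.
by rewrite mulset_subring; [exact: yT|exact: jaffard_sub].
Qed.

Lemma spanning_conductor T t : Theta T -> t \in T ->
  spanning D T [set c | c \in D /\ c * t \in D].
Proof.
move=> TT tT; split; last exact: flat_conductor (jaffard_flat jaffard TT) _.
split; last by move=> c [].
split; first split.
- by rewrite /= mul0r rpred0.
- by move=> y z [yD yt] [zD zt]; split; rewrite ?mulrDl; exact: rpredD.
- by move=> a y aD [yD yt]; split; rewrite -?mulrA; exact: rpredM.
Qed.

Lemma multiple_ideal T d : Theta T -> is_ideal D [set c | c \in D /\ c / d \in T].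
Proof.
move=> TT; have sDT := jaffard_sub TT; split; last by move=> c [].
split; first split.
- by rewrite /= mul0r !rpred0.
- by move=> y z [yD yt] [zD zt]; split; rewrite ?mulrDl; exact: rpredD.
- move=> a y aD [yD yt]; split; rewrite -?mulrA; apply: rpredM => //.
  exact: sDT.
Qed.

(** Independence gives [1/d] as a finite sum of products [t t']. If [c] is in the conductor of every
    [t] that occurs, then [c/d] is the sum of the [(c t) t'], hence in [T']. *)
Lemma spanning_multiple T T' d : Theta T -> Theta T' -> T <> T' -> d != 0 ->
  spanning D T [set c | c \in D /\ c / d \in T'].
Proof.
move=> TT TT' TT'neq d0.
have : mulset [set` T] [set` T'] d^-1 by rewrite (jaffard_independent jaffard).
case=> s sP dE.
apply: (spanning_sup (multiple_ideal _ TT') _ (spanning_all (jaffard_sub TT)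
  (c := fun p : K * K => [set c | c \in D /\ c * p.1 \in D]) (s := s) _)).
  move=> c [cD cs]; split=> //; rewrite dE mulr_sumr big_seq; apply: rpred_sum.
  move=> p ps; rewrite mulrA; apply: rpredM; last by case: (sP p ps).
  by apply: (jaffard_sub TT'); case: (cs p ps).
by move=> p /sP[pT _]; exact: spanning_conductor.
Qed.

(** By local finiteness [d] is a unit in all but finitely many [T'], where the condition is
    automatic; a finite intersection of ideals from [spanning_multiple] thus suffices. *)
Lemma spanning_multiples T d : Theta T -> d \in D -> d != 0 ->
  spanning D T [set c | c \in D /\
    forall T', Theta T' -> T' <> T -> c / d \in T'].
Proof.
move=> TT dD d0.
have /(@finite_seqP {classic (subringClosed K)})[s sE] :=
  jaffard_locally_finite jaffard dD d0.
have sP T' : (T' \in s) = `[< Theta T' /\ ~ is_unit T' d >].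
  by apply/idP/asboolP => [T's|T's]; [have : [set` s] T' by []|
    suff: [set` s] T' by []]; rewrite -sE.
(* The list may contain [T] itself; the guard [T' <> T] then makes its member all of [D]. *)
apply: (spanning_sup _ _ (spanning_all (jaffard_sub TT)
  (c := fun T' : {classic (subringClosed K)} =>
     [set c | c \in D /\ (T' <> T -> c / d \in (T' : subringClosed K))]) (s := s) _)).
- have -> : [set c | c \in D /\ forall T', Theta T' -> T' <> T -> c / d \in T'] =
    [set c | c \in D /\ forall T', Theta T' /\ T' <> T ->
       [set c | c \in D /\ c / d \in T'] c].
    apply/seteqP; split=> c [cD cT]; split=> // T'.
      by case=> ? ?; split=> //; exact: cT.
    by move=> T'T T'neq; have [] := cT T' (conj T'T T'neq).
  by apply: ideal_all => T' [T'T _]; exact: multiple_ideal.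
- move=> c [cD cs]; split=> // T' T'T T'neq.
  have [T's|T's] := boolP ((T' : {classic (subringClosed K)}) \in s).
    by have [_] := cs T' T's; exact.
  move: T's; rewrite sP; move=> /asboolP nT'.
  have [[_ [e eT' de]]|//] := pselect (is_unit T' d); last by move=> nu; case: nT'.
  apply: rpredM; first exact: (jaffard_sub T'T).
  by rewrite -(mulKf d0 e) de mulr1 in eT'.
- move=> T'; rewrite sP => /asboolP[T'T _].
  have [->|T'neq] := pselect (T' = T).
    have -> : [set c | c \in D /\ (T <> T -> c / d \in T)] = [set` D].
      by apply/seteqP; split=> [c []|c cD]//; split.
    exact: spanning_subring (jaffard_sub TT).
  have -> : [set c | c \in D /\ (T' <> T -> c / d \in (T' : subringClosed K))] =
    [set c | c \in D /\ c / d \in (T' : subringClosed K)].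
    by apply/seteqP; split=> [c [cD /(_ T'neq)]|c [cD cT']]; split.
  by apply: spanning_multiple => //; exact: nesym.
Qed.

(** As in the Chinese remainder theorem, [a = p t] where [p] is [1] modulo [d v] in [T] and a
    multiple of [d v] in the other members, [v] being a denominator of [t]. *)
Lemma jaffard_dense T t d : Theta T -> t \in T -> d \in D -> d != 0 ->
  exists2 a, a \in D & (a - t) / d \in T.
Proof.
move=> TT tT dD d0; have [u [v [uD vD v0 tE]]] := quoK t.
have dv0 : d * v != 0 by rewrite mulf_neq0.
have dvD : d * v \in D by exact: rpredM.
pose I1 := [set c | c \in D /\ forall T', Theta T' -> T' <> T -> c / (d * v) \in T'].
pose I2 := [set c | c \in D /\ c / (d * v) \in T].
have I2id : is_ideal D I2 by exact: multiple_ideal.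
pose I := [set c | exists2 p : K * K, I1 p.1 /\ I2 p.2 & c = p.1 + p.2].
have [[[I10 I1D] I1M] sI1] : is_ideal D I1.
  by have [] := spanning_multiples TT dvD dv0.
have [[[I20 I2D] I2M] sI2] := I2id.
have Iid : is_ideal D I.
  split; last by move=> _ [[p q] /= [Ip Iq] ->]; apply: rpredD; [exact: sI1|exact: sI2].
  split; first split.
  - by exists (0, 0); rewrite ?addr0.
  - move=> _ _ [[p q] /= [Ip Iq] ->] [[p' q'] /= [Ip' Iq'] ->].
    by exists (p + p', q + q'); rewrite 1?addrACA//; split; [exact: I1D|exact: I2D].
  - move=> a _ aD [[p q] /= [Ip Iq] ->]; exists (a * p, a * q); rewrite /= ?mulrDr//.
    by split; [exact: I1M|exact: I2M].
(* [I1] spans at [T] and [I2] at every other member, so [I1 + I2] is all of [D]. *)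
have [|[p q] /= [[pD pT] [qD qT]] pq1] := spanning_one Iid.
  move=> T' T'T; have [->|T'neq] := pselect (T' = T).
    apply: (spanning_sup Iid _ (spanning_multiples TT dvD dv0)).
    by move=> c Ic; exists (c, 0); rewrite ?addr0.
  apply: (spanning_sup Iid _ (spanning_multiple T'T TT T'neq dv0)).
  by move=> c Ic; exists (0, c); rewrite ?add0r.
(* Away from [T] the factor [p] absorbs the denominator [v] of [t]. *)
have ptT' T' : Theta T' -> p * t \in T'.
  move=> T'T; have sDT' := jaffard_sub T'T.
  have [->|T'neq] := pselect (T' = T).
    by apply: rpredM => //; exact: jaffard_sub pD.
  have -> : p * t = p / (d * v) * (d * u).
    have -> : u = v * t by rewrite tE mulrC divfK.
    by rewrite -{1}[p](divfK dv0) -!mulrA.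
  by apply: rpredM; [exact: pT|apply: rpredM; exact: sDT'].
exists (p * t); first exact: jaffard_bigcap ptT'.
(* The error is [- q t / d], and [q] is a multiple of [d v] in [T]. *)
have -> : (p * t - t) / d = - (q / (d * v) * (v * t)).
  have qt : q * t = q / (d * v) * (v * t) * d.
    by rewrite -{1}[q](divfK dv0) -!mulrA [d * (v * t)]mulrC -mulrA.
  rewrite -{2}[t]mul1r pq1 [(p + q) * t]mulrDl opprD addrA subrr sub0r.
  by rewrite mulNr qt mulfK.
by rewrite rpredN; apply: rpredM => //; apply: rpredM => //; exact: jaffard_sub vD.
Qed.

End JaffardFamily.

(** * Localization of Bhargava rings *)

Section BhargavaRing.
Variables (K : fieldType) (x : K).
Implicit Types (A : subringClosed K) (f : {poly K}).

Lemma bhargavaP A f : reflect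
  (forall a, a \in A -> f \Po (x *: 'X + a%:P) \is a polyOver A)
  (f \in bhargava A x).
Proof. exact: asboolP. Qed.

Lemma polyOver_shift A a : x \in A -> a \in A -> x *: 'X + a%:P \is a polyOver A.
Proof. by move=> xA aA; rewrite rpredD ?polyOverZ ?polyOverX ?polyOverC. Qed.

Lemma polyOver_bhargava A f :
  x \in A -> f \is a polyOver A -> f \in bhargava A x.
Proof.
by move=> xA fA; apply/bhargavaP => a aA; exact/polyOver_comp/polyOver_shift.
Qed.

Lemma clear_denominators A f : is_quotient_field A ->
  exists d, [/\ d \in A, d != 0 & d *: f \is a polyOver A].
Proof.
move=> quoA; elim/poly_ind: f => [|f c [d [dA d0 dfA]]].
  by exists 1; rewrite rpred1 oner_neq0 scaler0 rpred0.
have [a [b [aA bA b0 cE]]] := quoA c; exists (d * b).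
split; [exact: rpredM|exact: mulf_neq0|].
rewrite scalerDr rpredD//.
  by rewrite mulrC -scalerA scalerAl polyOverZ// rpredM ?polyOverX.
by rewrite -mul_polyC -polyCM polyOverC -mulrA cE [b * _]mulrC divfK// rpredM.
Qed.

Section Jaffard.
Variables (D : subringClosed K) (Theta : set (subringClosed K)).
Hypotheses (quoK : is_quotient_field D) (jaffard : jaffard_family D Theta).
Hypothesis xD : x \in D.
Implicit Types T : subringClosed K.

(* Writing [t = a - d s] with [a] in [D], where [d f] has coefficients in
   [D], [f(xX + t)] and [f(xX + a)] differ by an element of [T[X]]. *)
Lemma bhargava_sub T : Theta T -> {subset bhargava D x <= bhargava T x}.
Proof.
move=> TT f /bhargavaP fD; have sDT := jaffard_sub jaffard TT.
apply/bhargavaP => t tT; have [d [dD d0 dfD]] := clear_denominators f quoK.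
have [a aD asT] := jaffard_dense quoK jaffard TT tT dD d0.
have faT : f \Po (x *: 'X + a%:P) \is a polyOver T.
  by apply: (polyOverS sDT); exact: fD.
rewrite -(subrK (f \Po (x *: 'X + a%:P)) (f \Po _)) rpredD// !comp_polyE.
rewrite -sumrB rpred_sum// => i _; rewrite -scalerBr subrXX.
have -> : x *: 'X + t%:P - (x *: 'X + a%:P) = (d * ((t - a) / d))%:P.
  by rewrite opprD addrACA subrr add0r -polyCB mulrC divfK.
rewrite scalerAl rpredM//; last first.
  apply: rpred_sum => j _.
  by rewrite rpredM// rpredX// polyOver_shift//; exact: sDT.
rewrite -mul_polyC -polyCM polyOverC (mulrA f`_i) rpredM//.
  by rewrite mulrC; apply: sDT; move/polyOverP: dfD => /(_ i); rewrite coefZ.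
by rewrite -opprB mulNr rpredN.
Qed.

Lemma bhargava_bigcap f :
  (forall T, Theta T -> f \in bhargava T x) -> f \in bhargava D x.
Proof.
move=> fT; apply/bhargavaP => a aD; apply/polyOverP => i.
apply: (jaffard_bigcap jaffard) => T TT; apply/polyOverP.
by have /bhargavaP := fT T TT; apply; exact: (jaffard_sub jaffard TT).
Qed.

(** Let [d f] have coefficients in [D] and let [c] be a multiple of [d] in every [T' <> T]. Then
    [c f = (c/d) (d f)] has coefficients in [T'], and at [T] it is a constant of [D] times [f];
    [bhargava_bigcap] concludes. *)
Lemma spanning_bhargava T f : Theta T -> f \in bhargava T x ->
  spanning D T [set c | c \in D /\ c *: f \in bhargava D x].
Proof.
move=> TT fT; have [d [dD d0 dfD]] := clear_denominators f quoK.
apply: (spanning_sup _ _ (spanning_multiples quoK jaffard TT dD d0)).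
  split; last by move=> c [].
  split; first split.
  - by rewrite /= scale0r !rpred0.
  - by move=> y z [yD yt] [zD zt]; split; rewrite ?scalerDl; exact: rpredD.
  - move=> a y aD [yD yt]; split; first exact: rpredM.
    rewrite -scalerA -mul_polyC rpredM// polyOver_bhargava//.
    by rewrite polyOverC.
move=> c [cD cT]; split=> //; apply: bhargava_bigcap => T' T'T.
have sDT' := jaffard_sub jaffard T'T.
have [->|T'neq] := pselect (T' = T).
  rewrite -mul_polyC rpredM// polyOver_bhargava ?polyOverC//;
    exact: (jaffard_sub jaffard TT).
apply: polyOver_bhargava; first exact: sDT'.
rewrite -(divfK d0 c) -scalerA -mul_polyC rpredM ?polyOverC//; first exact: cT.
exact: (polyOverS sDT').
Qed.

End Jaffard.
End BhargavaRing.

(** * Local Picard groups *)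

Section LPicClasses.
Variables (L : fieldType).
Implicit Types (A B : subringClosed L).

Lemma invidealDE B (I J : invideal B) : (I + J : invideal B) = mulset I J :> set L.
Proof. by []. Qed.

Lemma mulset_invidealN B (I : invideal B) : mulset I (- I : invideal B) = [set` B].
Proof. by rewrite -invidealDE subrr. Qed.

Lemma invideal_submodule B (I : invideal B) : submodule B I.
Proof. by have [[]] := invidealP I. Qed.

Lemma mulset_principal B (I : set L) y : submodule B I ->
  mulset [set y * b | b in [set` B]] I = [set y * z | z in I].
Proof.
move=> [[I0 ID] IM]; apply/seteqP; split.
  apply: mulset_sub; first split.
  - by exists 0; rewrite ?mulr0.
  - by move=> _ _ [z Iz <-] [w Iw <-]; exists (z + w); rewrite ?mulrDr//; exact: ID.
  - by move=> _ z [b bB <-] Iz; exists (b * z); rewrite ?mulrA//; exact: IM.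
move=> _ [z Iz <-]; apply: mulset_mem => //.
by exists 1; rewrite ?mulr1//=; exact: rpred1.
Qed.

Definition is_fraction B (y : L) : Prop :=
  exists a b, [/\ a \in B, b \in B, b != 0 & y = a / b].

Lemma fractional_principal B y : is_fraction B y ->
  fractional B [set y * b | b in [set` B]].
Proof.
move=> [a [b [aB bB b0 yE]]]; split; last first.
  exists b; split=> // _ [z zB <-].
  by rewrite yE mulrA [b * _]mulrC divfK//; exact: rpredM.
split; first split.
- by exists 0; rewrite ?mulr0//=; exact: rpred0.
- by move=> _ _ [z zB <-] [w wB <-]; exists (z + w); rewrite ?mulrDr//; exact: rpredD.
- by move=> c _ cB [z zB <-]; exists (c * z); rewrite 1?mulrCA//; exact: rpredM.
Qed.

Lemma principal_group B y : y != 0 -> is_fraction B y -> is_fraction B y^-1 ->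
  exists P : invideal B, [/\ P \in @principal_invideal L B,
    P = [set y * b | b in [set` B]] :> set L &
    (- P : invideal B) = [set y^-1 * b | b in [set` B]] :> set L].
Proof.
move=> y0 yB yVB.
have yy z : z != 0 ->
    mulset [set z^-1 * b | b in [set` B]] [set z * b | b in [set` B]] = [set` B].
  move=> z0.
  rewrite mulset_principal; last first.
    split; first split.
    - by exists 0; rewrite ?mulr0//=; exact: rpred0.
    - by move=> _ _ [v vB <-] [w wB <-]; exists (v + w); rewrite ?mulrDr//; exact: rpredD.
    - by move=> c _ cB [v vB <-]; exists (c * v); rewrite 1?mulrCA//; exact: rpredM.
  apply/seteqP; split=> [_ [_ [b bB <-] <-]|b bB]; first by rewrite mulKf.
  by exists (z * b); [exists b|rewrite mulKf].
have yinv : invertible B [set y * b | b in [set` B]].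
  split; first exact: fractional_principal.
  exists [set y^-1 * b | b in [set` B]]; first exact: fractional_principal.
  by rewrite mulsetC yy.
have yVinv : invertible B [set y^-1 * b | b in [set` B]].
  split; first exact: fractional_principal.
  by exists [set y * b | b in [set` B]]; [exact: fractional_principal|rewrite yy].
exists (invideal_of yinv); split=> //.
  by apply/asboolP; exists y.
have -> // : - invideal_of yinv = invideal_of yVinv.
by apply/eqP; rewrite eq_sym -subr_eq0 opprK; apply/eqP/val_inj/yy.
Qed.

Section Classes.
Variables (B A : subringClosed L) (sAB : {subset A <= B}).

Definition LPic_class (I : invideal B) : LPic sAB :=
  \pi_(LPic sAB) (\pi_(Pic B) I).

Lemma LPic_classP c : exists I, c = LPic_class I.
Proof. by elim/quotW: c => p; elim/quotW: p => I; exists I. Qed.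

Lemma LPic_classB I J : LPic_class (I - J) = LPic_class I - LPic_class J.
Proof. by rewrite /LPic_class !raddfB. Qed.

(** Both quotients are unfolded; in multiplicative terms, [I = y J B] with [y] nonzero. *)
Lemma LPic_class_eq0 I : LPic_class I = 0 <->
  exists J : invideal A, I - ext_invideal sAB J \in @principal_invideal L B.
Proof.
have quotL := quot_pi0 (@Pic_ext_range L B A sAB : zmodClosed _).
have quotB := quot_pi0 (@principal_invideal L B : zmodClosed _).
split=> [/eqP|[J IJ]].
  rewrite quotL => /asboolP[c _]; elim/quotW: c => J; rewrite Pic_extE => JE.
  by exists J; move/eqP: JE; rewrite eq_sym -subr_eq0 -raddfB quotB.
apply/eqP; rewrite quotL; apply/asboolP; exists (\pi_(Pic A) J) => //.
by rewrite Pic_extE; apply/eqP; rewrite eq_sym -subr_eq0 -raddfB quotB.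
Qed.

Lemma LPic_class_principal P : P \in @principal_invideal L B -> LPic_class P = 0.
Proof. by move=> PP; apply/LPic_class_eq0; exists 0; rewrite raddf0 subr0. Qed.

End Classes.

(** * Functoriality of the local Picard group *)

Section LPicMap.
Variables (A B A' B' : subringClosed L).
Hypotheses (sAB : {subset A <= B}) (sAB' : {subset A' <= B'}).
Hypotheses (sAA' : {subset A <= A'}) (sBB' : {subset B <= B'}).

Definition LPic_map (c : LPic sAB) : LPic sAB' :=
  \pi_(LPic sAB') (Pic_ext sBB' (repr c)).

Lemma ext_invideal_comm (J : invideal A) :
  ext_invideal sBB' (ext_invideal sAB J) = ext_invideal sAB' (ext_invideal sAA' J).
Proof.
by apply: val_inj; rewrite /= -!mulsetA !mulset_subring.
Qed.

Lemma principal_ext (I : invideal B) : I \in @principal_invideal L B ->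
  ext_invideal sBB' I \in @principal_invideal L B'.
Proof.
have quotB := quot_pi0 (@principal_invideal L B : zmodClosed _).
have quotB' := quot_pi0 (@principal_invideal L B' : zmodClosed _).
by rewrite -quotB -quotB' -Pic_extE => /eqP->; rewrite raddf0.
Qed.

(** Two representatives differ by a principal ideal times one extended from [A]. By
    [ext_invideal_comm], extension to [B'] makes this a principal ideal times one extended from
    [A']. *)
Lemma LPic_mapE I : LPic_map (LPic_class sAB I) =
  LPic_class sAB' (ext_invideal sBB' I).
Proof.
rewrite /LPic_map; set p := repr _.
have [J pE] : exists J, p = \pi_(Pic B) J by elim/quotW: p => J; exists J.
have : LPic_class sAB (J - I) = 0.
  rewrite LPic_classB; apply/eqP; rewrite subr_eq0; apply/eqP.
  by rewrite [LHS]/LPic_class -pE /p reprK.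
move=> /LPic_class_eq0[N JIN]; rewrite pE Pic_extE.
apply/eqP; rewrite -subr_eq0 -!raddfB; apply/eqP/LPic_class_eq0.
exists (ext_invideal sAA' N); rewrite -ext_invideal_comm -raddfB.
exact: principal_ext.
Qed.

Lemma LPic_map_is_zmod_morphism : zmod_morphism LPic_map.
Proof.
move=> c e; have [I ->] := LPic_classP c; have [J ->] := LPic_classP e.
by rewrite -LPic_classB !LPic_mapE raddfB LPic_classB.
Qed.

End LPicMap.
End LPicClasses.

(** * Localization and gluing of submodules *)

Section Localization.
Variables (K L : fieldType) (phi : {rmorphism K -> L}) (D : subringClosed K).
Variables (B B' : subringClosed L).
Implicit Types (T : subringClosed K) (M N : set L).

Local Notation Dphi := (image_subring phi D).

Lemma submodule_sub (A A' : subringClosed L) M : {subset A <= A'} ->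
  submodule A' M -> submodule A M.
Proof. by move=> sA [Madd MM]; split=> // a y /sA; exact: MM. Qed.

Section Extension.
Variable T : subringClosed K.
Hypothesis sDT : {subset D <= T}.
Hypothesis sDB : {subset Dphi <= B}.
Hypothesis sTB' : {subset image_subring phi T <= B'}.
Hypothesis spanB : forall b, b \in B' ->
  spanning D T (residual phi D [set` B] b).

(* Extending a [B]-module [M] to [B'] amounts to localizing it at [T]. *)
Lemma mulset_ext_residual M y : submodule B M ->
  mulset M [set` B'] y <-> spanning D T (residual phi D M y).
Proof.
move=> MB; have MD := submodule_sub sDB MB; split=> [[s sP ->]|[_ [s sP s1]]].
  (* For [y = sum m_k b_k], any [c] that brings every [b_k] into [B] brings [y] into [M], and such
     [c] form a spanning ideal. *)
  apply: (spanning_sup (residual_ideal _ MD) _ (spanning_all sDT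
    (c := fun p : L * L => residual phi D [set` B] p.2) (s := s) _)).
    move=> c [cD cs]; split=> //; rewrite mulr_sumr big_seq.
    have [[M0 MA] MM] := MB.
    elim/big_ind: _ => // p ps; rewrite mulrCA mulrC; apply: MM.
      by case: (cs p ps).
    by case: (sP p ps).
  by move=> p /sP[_]; exact: spanB.
(* Conversely, [1 = sum c_k t_k] with all [c_k y] in [M] gives [y = sum (c_k y) t_k]. *)
rewrite -[y]mul1r -(rmorph1 phi) s1 rmorph_sum mulr_suml.
exists [seq (phi p.1 * y, phi p.2) | p <- s] => [p|].
  move=> /mapP[q /sP[[qD Mq] qT] ->]; split=> //=.
  by apply: sTB'; exact: mem_image_subring.
by rewrite big_map; apply: eq_bigr => p _ /=; rewrite rmorphM mulrAC.
Qed.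

End Extension.

(** Where [1 = sum m_k n_k] at [T], the [c] bringing all [m_k] into [M] and the [e] bringing all
    [n_k] into [N] form spanning ideals, and each [c e] lies in [(MN : 1)]. That ideal therefore
    spans at every [T]. *)
Lemma glue_one (Theta : set (subringClosed K)) M N :
  jaffard_family D Theta -> submodule Dphi M -> submodule Dphi N ->
  (forall T, Theta T -> mulset [set y | spanning D T (residual phi D M y)]
     [set y | spanning D T (residual phi D N y)] 1) ->
  mulset M N 1.
Proof.
move=> jaffard MD ND MN1; apply: (@residual1 _ _ phi D).
have MND : submodule Dphi (mulset M N) by exact: submodule_mulset.
apply: (spanning_one jaffard); first exact: residual_ideal.
move=> T TT; have sDT := jaffard_sub jaffard TT; have [s sP s1] := MN1 T TT.
have := spanning_mulset
  (spanning_all sDT (c := fun p : L * L => residual phi D M p.1) (s := s)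
    (fun p ps => proj1 (sP p ps)))
  (spanning_all sDT (c := fun p : L * L => residual phi D N p.2) (s := s)
    (fun p ps => proj2 (sP p ps))).
apply: spanning_sup; first exact: residual_ideal.
have [[Radd _] _] := residual_ideal 1 MND.
apply: mulset_sub => // c e [cD cM] [eD eN]; split; first exact: rpredM.
rewrite s1 mulr_sumr big_seq.
have [P0 PD] : addclosed (mulset M N) by exact: mulset_addclosed.
elim/big_ind: _ => // p ps; rewrite rmorphM mulrACA.
by apply: mulset_mem; [case: (cM p ps)|case: (eN p ps)].
Qed.

End Localization.

(** * Representatives of ideal classes inside a principal ideal ring *)

Section Normalization.
Variables (L : fieldType) (P : set L) (B : subringClosed L).
Hypotheses (Padd : addclosed P) (PM : forall y z, P y -> P z -> P (y * z)).
Hypotheses (sBP : [set` B] `<=` P) (Pfrac : forall y, P y -> is_fraction B y).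

(** The group is written additively, so [- I] is the inverse ideal; in the application [P] is the
    image of [K[X]]. *)
Definition normal (I : invideal B) : Prop :=
  I `<=` P /\ (- I : invideal B) `<=` P.

Lemma fractionV y : y != 0 -> is_fraction B y -> is_fraction B y^-1.
Proof.
move=> y0 [a [b [aB bB b0 yE]]]; exists b, a; split=> //; last by rewrite yE invf_div.
by apply: contraNneq y0 => a0; rewrite yE a0 mul0r.
Qed.

Lemma fraction_div y z : is_fraction B y -> is_fraction B z -> z != 0 ->
  is_fraction B (y / z).
Proof.
move=> [a [b [aB bB b0 ->]]] [c [d [cB dB d0 ->]]].
rewrite mulf_eq0 invr_eq0 negb_or => /andP[c0 _].
exists (a * d), (b * c); split; [exact: rpredM..|exact: mulf_neq0|].
by rewrite invf_div mulf_div.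
Qed.

Lemma normalN (I : invideal B) : normal I -> normal (- I).
Proof. by case=> IP NIP; split; rewrite ?opprK. Qed.

(** That is, [P] is a principal ideal ring, [g] being a generator of its ideal [N]. *)
Hypothesis Pideal : forall N : set L, addclosed N ->
  (forall p z, P p -> N z -> N (p * z)) -> N `<=` P -> (exists2 z, N z & z != 0) ->
  exists g, [/\ N g, g != 0 & forall z, N z -> P (z / g)].

(** If [d I] is in [B], then [N = d I P] is an ideal of [P], generated by some [g], so [I P = y P]
    with [y = g / d]. Hence [I / y] lies in [P]; so does its inverse [y I^-1], because [y] is in
    [I P] and [I I^-1 = B] is in [P]. *)
Lemma normalize (I : invideal B) :
  exists2 I', normal I' & I - I' \in @principal_invideal _ B.
Proof.
have [[_ [d [dB d0 dI]]] _] := invidealP I.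
have [[I0 ID] IM] := invideal_submodule I.
pose N : set L := [set d * z | z in mulset I P].
have [MD0 MDD] : addclosed (mulset I P) by exact: mulset_addclosed.
have Nadd : addclosed N.
  split; first by exists 0; rewrite ?mulr0.
  by move=> _ _ [y My <-] [z Mz <-]; exists (y + z); rewrite ?mulrDr//; exact: MDD.
have NM p z : P p -> N z -> N (p * z).
  move=> pP [y [s sP ->] <-]; exists (p * \sum_(q <- s) q.1 * q.2);
    last by rewrite mulrCA.
  exists [seq (q.1, p * q.2) | q <- s] => [q|].
    by move=> /mapP[r /sP[Ir rP] ->]; split=> //; exact: PM.
  by rewrite big_map mulr_sumr; apply: eq_bigr => q _ /=; rewrite mulrCA.
have Npoly : N `<=` P.
  move=> _ [y My <-]; move: y My.
  apply: (@mulset_sub _ _ _ [set y | P (d * y)]).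
    have [P0 PD] := Padd.
    by split=> [|y z yP zP]; rewrite /= ?mulr0// mulrDr; exact: PD.
  move=> i j Ii jP /=; rewrite mulrA; apply: PM => //.
  exact: sBP (dI i Ii).
have P1 : P 1 by apply: sBP; exact: rpred1.
have Nd z : (I : set L) z -> N (d * z).
  by move=> Iz; exists z => //; rewrite -[z]mulr1; exact: mulset_mem.
have [z Iz z0] : exists2 z, (I : set L) z & z != 0.
  apply: contrapT => Inz; have : mulset I (- I : invideal B) 1.
    by rewrite mulset_invidealN /=; exact: rpred1.
  have N1 : mulset I (- I : invideal B) `<=` [set 0].
    apply: mulset_sub; first by split=> // y z -> ->; rewrite addr0.
    move=> i j Ii _ /=; have [->|i0] := eqVneq i 0; first exact: mul0r.
    by case: Inz; exists i.
  by move=> /N1 /eqP; rewrite oner_eq0.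
have [|g [Ng g0 Ndiv]] := Pideal Nadd NM Npoly.
  by exists (d * z); [exact: Nd|rewrite mulf_neq0].
pose y := g / d.
have y0 : y != 0 by rewrite mulf_neq0 ?invr_eq0.
have dfrac : is_fraction B d by exact/Pfrac/sBP.
have gfrac : is_fraction B g by exact/Pfrac/Npoly.
have yfrac : is_fraction B y by exact: fraction_div.
have [Q [Qprin QE QNE]] := principal_group y0 yfrac (fractionV y0 yfrac).
exists (I - Q); last by rewrite opprB addrC subrK.
split.
  rewrite addrC invidealDE QNE mulset_principal; last exact: invideal_submodule.
  move=> _ [w Iw <-]; rewrite invf_div mulrAC; exact: Ndiv (Nd w Iw).
rewrite opprB invidealDE QE mulset_principal; last exact: invideal_submodule.
move=> _ [w Iw <-].
have [v Mv dv] := Ng; rewrite /y -dv [d * v]mulrC mulfK//; move: v Mv {dv}.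
apply: (@mulset_sub _ _ _ [set v | P (v * w)]).
  exact: addclosed_preim Padd.
move=> i j Ii jP /=; rewrite mulrAC; apply: PM => //.
have : mulset I (- I : invideal B) (i * w) by exact: mulset_mem.
by rewrite mulset_invidealN => /sBP.
Qed.

End Normalization.

(** * Decomposition of the local Picard group *)

Section Decomposition.
Variables (K L : fieldType) (phi : {rmorphism K -> L}) (D : subringClosed K).
Variable Theta : set (subringClosed K).
Hypotheses (quoK : is_quotient_field D) (jaffard : jaffard_family D Theta).
(** In the application [L = K(X)], [phi] embeds the constants, [P] is the image of [K[X]] and [BB A]
    that of the Bhargava ring of [A]; the hypotheses collect what the argument uses of them. *)
Variables (P : set L) (BB : subringClosed K -> subringClosed L).
Hypotheses (Padd : addclosed P) (PM : forall y z, P y -> P z -> P (y * z)).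
Hypothesis Pphi : forall c, P (phi c).
Hypothesis Pideal : forall N : set L, addclosed N ->
  (forall p z, P p -> N z -> N (p * z)) -> N `<=` P -> (exists2 z, N z & z != 0) ->
  exists g, [/\ N g, g != 0 & forall z, N z -> P (z / g)].
Hypothesis Punit : forall y, y != 0 -> P y -> P y^-1 -> exists c, y = phi c.
Hypothesis sCB : forall A, {subset image_subring phi A <= BB A}.
Hypothesis sBP : forall A, [set` BB A] `<=` P.
Hypothesis sBB : forall T, Theta T -> {subset BB D <= BB T}.
Hypothesis BBcap : forall y, P y -> (forall T, Theta T -> y \in BB T) -> y \in BB D.
Hypothesis BBconst : forall c, phi c \in BB D -> c \in D.
Hypothesis Pclear : forall y, P y ->
  exists d, [/\ d \in D, d != 0 & phi d * y \in BB D].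
Hypothesis spanB : forall T b, Theta T -> b \in BB T ->
  spanning D T (residual phi D [set` BB D] b).

Local Notation C A := (image_subring phi A).
Local Notation normal := (normal P).
Local Notation index := {T : subringClosed K | Theta T}.

Lemma phi_neq0 d : d != 0 -> phi d != 0.
Proof. by rewrite fmorph_eq0. Qed.

Lemma constant_mem c : c \in D -> phi c \in BB D.
Proof. by move=> cD; apply: sCB; exact: mem_image_subring. Qed.

Section NormalIdeals.
Variable A : subringClosed K.
Hypothesis sBA : {subset BB D <= BB A}.

Lemma P_fraction y : P y -> is_fraction (BB A) y.
Proof.
move=> /Pclear[d [dD d0 dyB]]; have pd0 := phi_neq0 d0.
exists (phi d * y), (phi d); split=> //; last by rewrite mulrC mulKf.
  exact: sBA.
by apply: sBA; exact: constant_mem.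
Qed.

Lemma normal_representative (I : invideal (BB A)) :
  exists2 I', normal I' & I - I' \in @principal_invideal _ (BB A).
Proof. exact: normalize (sBP (A := A)) P_fraction Pideal I. Qed.

(** The elements that a nonzero constant of [D] multiplies into [I] are closed under sums. They
    contain [I I^-1], since denominators of the polynomials in [I^-1] can be cleared, and hence
    contain [1]. *)
Lemma normal_const (I : invideal (BB A)) : normal I ->
  exists d, [/\ d \in D, d != 0 & (I : set L) (phi d)].
Proof.
move=> [_ NIP]; have [[I0 ID] IM] := invideal_submodule I.
have constA c : c \in D -> phi c \in BB A by move=> /constant_mem; exact: sBA.
pose N : set L := [set z | exists d, [/\ d \in D, d != 0 & (I : set L) (phi d * z)]].
have : mulset I (- I : invideal (BB A)) `<=` N.
  apply: mulset_sub.
    split; first by exists 1; rewrite rpred1 oner_neq0 mulr0.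
    move=> z w [d [dD d0 Idz]] [e [eD e0 Iew]].
    exists (d * e); split; [exact: rpredM|exact: mulf_neq0|].
    rewrite rmorphM mulrDr; apply: ID.
      by rewrite mulrAC mulrC; apply: IM => //; exact: constA.
    by rewrite -mulrA; apply: IM => //; exact: constA.
  move=> i j Ii /NIP jP; have [d [dD d0 djB]] := Pclear jP.
  by exists d; split=> //; rewrite mulrCA mulrC; apply: IM => //; exact: sBA.
move=> /(_ 1); rewrite mulset_invidealN => /(_ (rpred1 _))[d [dD d0]].
by rewrite mulr1 => Id; exists d.
Qed.

Lemma normal_const2 (I : invideal (BB A)) : normal I ->
  exists d, [/\ d \in D, d != 0, (I : set L) (phi d) &
    ((- I : invideal (BB A)) : set L) (phi d)].
Proof.
move=> nI; have [d [dD d0 Id]] := normal_const nI.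
have [e [eD e0 Ie]] := normal_const (normalN nI).
have constA c : c \in D -> phi c \in BB A by move=> /constant_mem; exact: sBA.
exists (d * e); split; [exact: rpredM|exact: mulf_neq0|..].
  rewrite mulrC rmorphM; have [_ IM] := invideal_submodule I.
  by apply: IM => //; exact: constA.
rewrite rmorphM; have [_ IM] := invideal_submodule (- I : invideal (BB A)).
by apply: IM => //; exact: constA.
Qed.

End NormalIdeals.

Lemma ext_residual T (M : set L) y : Theta T -> submodule (BB D) M ->
  mulset M [set` BB T] y <-> spanning D T (residual phi D M y).
Proof.
move=> TT; have sDT := jaffard_sub jaffard TT.
by apply: (mulset_ext_residual sDT (@sCB D) (@sCB T)) => b; exact: spanB.
Qed.

Section UnitExtension.
Variables (T : subringClosed K) (TT : Theta T).

(** The unit makes both extensions contain [BB T]. As the extension [I'] of [I] then has [1] in its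
    inverse, [I'] is contained in [I' I'^-1 = BB T]. *)
Lemma ext_invideal_unit (I : invideal (BB D)) d :
  is_unit T d -> (I : set L) (phi d) -> ((- I : invideal (BB D)) : set L) (phi d) ->
  ext_invideal (sBB TT) I = 0.
Proof.
move=> [dT [e eT de]] Id NId.
have peT : phi e \in BB T by apply: sCB; exact: mem_image_subring.
have sub (J : invideal (BB D)) : (J : set L) (phi d) ->
    [set` BB T] `<=` (ext_invideal (sBB TT) J : set L).
  move=> Jd b bT; have -> : b = phi d * (phi e * b).
    by rewrite mulrA -rmorphM de rmorph1 mul1r.
  by apply: mulset_mem => //; exact: rpredM.
apply/val_inj/seteqP; split; last exact: sub.
have -> : (0 : invideal (BB T)) = ext_invideal (sBB TT) I + ext_invideal (sBB TT) (- I).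
  by rewrite -raddfD subrr raddf0.
rewrite /= -[X in _ `<=` X]/(mulset (ext_invideal (sBB TT) I)
  (ext_invideal (sBB TT) (- I))).
move=> z Iz; rewrite -[z]mulr1; apply: mulset_mem => //.
by apply: (sub _ NId); exact: rpred1.
Qed.

End UnitExtension.

Lemma sub_constants (T : subringClosed K) (TT : Theta T) : {subset C D <= C T}.
Proof.
move=> _ /asboolP[c cD <-]; apply: mem_image_subring.
exact: (jaffard_sub jaffard TT).
Qed.

Definition local_classes (c : LPic (@sCB D)) :
    direct_prod (fun i : index => LPic (@sCB (proj1_sig i))) :=
  fun i => LPic_map (@sCB (proj1_sig i)) (sBB (proj2_sig i)) c.

Lemma local_classesE I (i : index) : local_classes (LPic_class (@sCB D) I) i =
  LPic_class (@sCB (proj1_sig i)) (ext_invideal (sBB (proj2_sig i)) I).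
Proof. by rewrite /local_classes LPic_mapE//; exact: sub_constants (proj2_sig i). Qed.

Lemma normal_class A (sBA : {subset BB D <= BB A}) (c : LPic (@sCB A)) :
  exists2 I, normal I & c = LPic_class (@sCB A) I.
Proof.
have [I ->] := LPic_classP c; have [I' nI' II'] := normal_representative sBA I.
exists I' => //; apply/eqP; rewrite -subr_eq0 -LPic_classB; apply/eqP.
exact: LPic_class_principal.
Qed.

Lemma local_classes_finsupp c : local_classes c \in @finsupp_pred _ _.
Proof.
have [I nI ->] := @normal_class D (fun y => id) c.
have [d [dD d0 Id NId]] := @normal_const2 D (fun y => id) I nI.
apply/asboolP.
have fin := jaffard_locally_finite jaffard dD d0.
have inj : {in @proj1_sig _ Theta @^-1` [set T | Theta T /\ ~ is_unit T d] &,
    injective (@proj1_sig _ Theta)}.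
  by move=> [T TT] [T' T'T] _ _ /= TT'; exact: eq_exist.
apply: sub_finite_set (finite_preimage inj fin).
move=> [T TT] /= nz; split=> // uT; apply: nz.
by rewrite local_classesE (ext_invideal_unit TT uT Id NId) /LPic_class !raddf0.
Qed.

Definition local_sum (c : LPic (@sCB D)) :
    direct_sum (fun i : index => LPic (@sCB (proj1_sig i))) :=
  DirectSum (local_classes_finsupp c).

Lemma local_sum_is_zmod_morphism : zmod_morphism local_sum.
Proof.
move=> c e; apply: val_inj; apply: functional_extensionality_dep => i.
have subTi := sub_constants (proj2_sig i).
exact: (@LPic_map_is_zmod_morphism _ _ _ _ _ (@sCB D) (@sCB (proj1_sig i)) subTi).
Qed.

HB.instance Definition _ := GRing.isZmodMorphism.Build _ _ local_sum
  local_sum_is_zmod_morphism.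

Lemma principalN (B : subringClosed L) (Q : invideal B) y : y != 0 ->
  Q = [set y * b | b in [set` B]] :> set L ->
  (- Q : invideal B) = [set y^-1 * b | b in [set` B]] :> set L.
Proof.
move=> y0 QE; have := mulset_invidealN Q.
rewrite QE mulset_principal; last exact: invideal_submodule.
move=> <-; apply/seteqP; split=> [z Qz|_ [_ [z Qz <-] <-]]; last by rewrite mulKf.
by exists (y * z); [exists z|rewrite mulKf].
Qed.

Lemma sub_principal_ext (A B : subringClosed L) (sAB : {subset A <= B})
    (J : invideal A) y j : (J : set L) j ->
  [set y * z | z in (ext_invideal sAB J : set L)] (y * j).
Proof.
move=> Jj; exists j => //; rewrite -[j]mulr1; apply: mulset_mem => //.
exact: rpred1.
Qed.

Lemma submodule_constants (M : set L) : submodule (BB D) M ->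
  submodule (C D) (M `&` range phi).
Proof.
move=> [[M0 MD] MM]; split; first split.
- by split=> //; exists 0; rewrite ?rmorph0.
- move=> y z [My [c _ yE]] [Mz [e _ zE]]; split; first exact: MD.
  by exists (c + e); rewrite // rmorphD yE zE.
- move=> _ y /asboolP[a aD <-] [My [c _ yE]].
  split; last by exists (a * c); rewrite // rmorphM yE.
  by apply: MM => //; exact: constant_mem.
Qed.

(* If [I] becomes [y J] with [J] extended from [T], then [y] and [1/y] are
   polynomials, hence [y] is a constant, so that [I] and its inverse are
   generated by constants over [T]. *)
Lemma local_constants T (TT : Theta T) (I : invideal (BB D)) :
  normal I -> LPic_class (@sCB T) (ext_invideal (sBB TT) I) = 0 ->
  mulset [set z | spanning D T (residual phi D (I `&` range phi) z)]
    [set z | spanning D T (residual phi D ((- I : invideal (BB D)) `&` range phi) z)] 1.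
Proof.
move=> [IP NIP] /LPic_class_eq0[J /asboolP[y y0 QE]].
have NQE := principalN y0 QE.
set Q := ext_invideal _ _ - ext_invideal _ _ in QE NQE.
have IE : ext_invideal (sBB TT) I =
    [set y * z | z in (ext_invideal (@sCB T) J : set L)] :> set L.
  rewrite -(mulset_principal (B := BB T)); last exact: invideal_submodule.
  by rewrite -QE -invidealDE subrK.
have NIE : ext_invideal (sBB TT) (- I) =
    [set y^-1 * z | z in (ext_invideal (@sCB T) (- J) : set L)] :> set L.
  rewrite -(mulset_principal (B := BB T)); last exact: invideal_submodule.
  by rewrite -NQE -invidealDE !raddfN opprB addrAC subrr add0r.
have TfracK (N : invideal (C T)) : (N : set L) `<=` range phi.
  move=> z Nz; have [[_ [d [/asboolP[c cT <-] d0 dN]]] _] := invidealP N.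
  have /asboolP[e eT ez] := dN z Nz.
  by exists (e / c) => //; rewrite fmorph_div ez mulrC mulKf.
have P0D := Padd.
have extP (N : invideal (BB D)) : (N : set L) `<=` P ->
    (ext_invideal (sBB TT) N : set L) `<=` P.
  by move=> NP; apply: mulset_sub => // i j /NP iP /(@sBP T) jP; exact: PM.
(* The inverse of [N] lies in [K] by [TfracK], so multiplying [z N] by it recovers [z] as a
   polynomial. *)
have polyof (N : invideal (C T)) z :
    (forall j, (N : set L) j -> P (z * j)) -> P z.
  move=> zN; have : mulset N (- N : invideal (C T)) 1.
    by rewrite mulset_invidealN; exact: rpred1.
  suff sub : mulset N (- N : invideal (C T)) `<=` [set w | P (z * w)].
    by move=> /sub /=; rewrite mulr1.
  apply: mulset_sub; first by split=> [|v w]; rewrite /= ?mulr0 ?mulrDr; apply P0D.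
  move=> i j Ni /TfracK[c _ <-] /=; rewrite mulrA; apply: PM => //.
  exact: zN.
have Jext j : (J : set L) j -> (ext_invideal (sBB TT) I : set L) (y * j).
  by rewrite IE; exact: sub_principal_ext.
have NJext j : ((- J : invideal (C T)) : set L) j ->
    (ext_invideal (sBB TT) (- I) : set L) (y^-1 * j).
  by rewrite NIE; exact: sub_principal_ext.
have yP : P y by apply: (polyof J) => j /Jext; exact: extP.
have yVP : P y^-1 by apply: (polyof (- J)) => j /NJext; exact: extP.
have [c yE] := Punit y0 yP yVP.
have resid (N : invideal (BB D)) z :
    (ext_invideal (sBB TT) N : set L) z -> range phi z ->
    spanning D T (residual phi D (N `&` range phi) z).
  move=> /(ext_residual _ TT (invideal_submodule N)) Nz [e _ ez].
  (* Multiples of a constant by elements of [D] stay constant, so intersecting with [K] leaves the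
     residual unchanged. *)
  have -> // : residual phi D (N `&` range phi) z = residual phi D N z.
  apply/seteqP; split=> [a [aD []]//|a [aD Na]]; split=> //; split=> //.
  by exists (a * e); rewrite // rmorphM ez.
have : mulset J (- J : invideal (C T)) 1.
  by rewrite mulset_invidealN; exact: rpred1.
move: 1; apply: mulset_sub; first exact: mulset_addclosed.
move=> i j Ji Jj.
(* Inserting [y / y] splits the product into a constant of the extension of [I] and one of the
   extension of its inverse. *)
have -> : i * j = (y * i) * (y^-1 * j) by rewrite mulrACA divff// mul1r.
have [a _ ia] := TfracK _ _ Ji; have [b _ jb] := TfracK _ _ Jj.
apply: mulset_mem; apply: resid.
- exact: Jext.
- by exists (c * a); rewrite // rmorphM -yE ia.
- exact: NJext.
- by exists (c^-1 * b); rewrite // rmorphM fmorphV -yE jb.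
Qed.

(** By [local_constants], the local identities glue to [1] in [J N], while elements of [J N] are
    constants of [BB D], hence come from [D]. So [J] is invertible, and it extends to [I]. *)
Lemma local_sum_injective : injective local_sum.
Proof.
apply: raddf_inj => c c0.
have [I nI cE] := @normal_class D (fun y => id) c.
have locI T (TT : Theta T) : LPic_class (@sCB T) (ext_invideal (sBB TT) I) = 0.
  have : local_classes c (exist _ T TT) = 0.
    exact: (congr1 (fun f => direct_sum_val f (exist _ T TT)) c0).
  by rewrite cE local_classesE.
pose J : set L := I `&` range phi.
pose N : set L := (- I : invideal (BB D)) `&` range phi.
have JC : submodule (C D) J by exact/submodule_constants/invideal_submodule.
have NC : submodule (C D) N by exact/submodule_constants/invideal_submodule.
have JN1 : mulset J N 1.
  by apply: (glue_one jaffard JC NC) => T TT; exact: local_constants.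
have JNC : mulset J N = [set` C D].
  apply/seteqP; split.
    apply: mulset_sub; first by have [] := subring_submodule (C D).
    move=> i j [Ii [a _ aE]] [Ij [b _ bE]].
    have : mulset I (- I : invideal (BB D)) (i * j) by exact: mulset_mem.
    rewrite mulset_invidealN -aE -bE -rmorphM => abB.
    by apply: mem_image_subring; exact: BBconst.
  move=> z zC; rewrite -[z]mulr1; have [_] : submodule (C D) (mulset J N).
    exact: submodule_mulset.
  exact.
have [d [dD d0 Id NId]] := @normal_const2 D (fun y => id) I nI.
have Jfrac : fractional (C D) J.
  split=> //; exists (phi d); split; [exact: mem_image_subring|exact: phi_neq0|].
  move=> z Jz; suff : [set` C D] (phi d * z) by [].
  by rewrite -JNC mulrC; apply: mulset_mem => //; split=> //; exists d.
have Nfrac : fractional (C D) N.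
  split=> //; exists (phi d); split; [exact: mem_image_subring|exact: phi_neq0|].
  move=> z Nz; suff : [set` C D] (phi d * z) by [].
  by rewrite -JNC; apply: mulset_mem => //; split=> //; exists d.
have Jinv : invertible (C D) J by split=> //; exists N.
rewrite cE; apply/LPic_class_eq0; exists (invideal_of Jinv).
have -> : ext_invideal (@sCB D) (invideal_of Jinv) = I; last first.
  by rewrite subrr rpred0.
have [[I0 ID] IM] := invideal_submodule I.
apply/val_inj/seteqP; split.
  by apply: mulset_sub => // i j [Ii _] jB; rewrite mulrC; exact: IM.
(* From [1 = sum j n] follows [z = sum j (n z)], where [n z] lies in [I^-1 I = BB D]. *)
move=> z Iz; have [s sP s1] := JN1.
rewrite -[z]mul1r s1 mulr_suml; exists [seq (p.1, p.2 * z) | p <- s] => [p|].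
  move=> /mapP[q /sP[Jq [Nq _]] ->]; split=> //=.
  have : mulset I (- I : invideal (BB D)) (z * q.2) by exact: mulset_mem.
  by rewrite mulset_invidealN mulrC.
by rewrite big_map; apply: eq_bigr => p _; rewrite mulrA.
Qed.

(** The intersection is taken inside the polynomials, where [BBcap] applies. *)
Definition glued (M : index -> set L) : set L :=
  [set y | P y /\ forall i, M i y].

Lemma glued_submodule (M : index -> set L) :
  (forall i, submodule (BB (proj1_sig i)) (M i)) -> submodule (BB D) (glued M).
Proof.
move=> MB; split; first split.
- by split=> [|i]; [exact: Padd.1|have [[]] := MB i].
- move=> y z [yP My] [zP Mz]; split=> [|i]; first exact: Padd.2.
  by have [[_ MD] _] := MB i; exact: MD.
- move=> b y bB [yP My]; split=> [|i]; first by apply: PM => //; exact: sBP bB.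
  by have [_ MM] := MB i; apply: MM => //; exact: sBB (proj2_sig i) b bB.
Qed.

(** Let [e y] be in [BB D] and let [c] be a multiple of [d e] in every member other than that of
    [i]. Then [c y = (c / (d e)) d (e y)] is in [M j] for [j <> i] because [d] is, and in [M i]
    because [y] is. *)
Lemma spanning_glued (M : index -> set L) d i y :
  (forall j, submodule (BB (proj1_sig j)) (M j)) ->
  d \in D -> d != 0 -> (forall j, M j (phi d)) -> P y -> M i y ->
  spanning D (proj1_sig i) (residual phi D (glued M) y).
Proof.
move=> MB dD d0 Md yP My; have [e [eD e0 eyB]] := Pclear yP.
have de0 : d * e != 0 by rewrite mulf_neq0.
have MC : submodule (C D) (glued M).
  exact: submodule_sub (@sCB D) (glued_submodule MB).
apply: (spanning_sup (residual_ideal _ MC) _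
  (spanning_multiples quoK jaffard (proj2_sig i) (rpredM dD eD) de0)).
move=> c [cD cT]; split=> //; split=> [|j]; first exact: PM.
have [_ MM] := MB j.
have [ji|ji] := pselect (proj1_sig j = proj1_sig i).
  have -> : j = i by case: j i {MM My cT} ji => [T TT] [T' T'T] /= ?; exact: eq_exist.
  have [_ MMi] := MB i; apply: MMi => //; apply: sCB; apply: mem_image_subring.
  exact: (jaffard_sub jaffard (proj2_sig i)).
rewrite -(divfK de0 c) !rmorphM -[_ * y]mulrA -[phi d * phi e * y]mulrA.
rewrite [phi d * _]mulrC mulrA; apply: MM => //; apply: rpredM; last first.
  exact: sBB (proj2_sig j) _ eyB.
rewrite -rmorphM; apply: sCB; apply: mem_image_subring.
exact: cT (proj2_sig j) ji.
Qed.

Lemma local_sum_surjective h : exists c, local_sum c = h.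
Proof.
pose g := direct_sum_val h.
(* Choosing the unit ideal itself off the support leaves only finitely many ideals to control. *)
have ex (i : index) : exists I : invideal (BB (proj1_sig i)),
    [/\ normal I, g i = LPic_class (@sCB (proj1_sig i)) I & g i = 0 -> I = 0].
  have [h0|h0] := pselect (g i = 0); last first.
    by have [I nI hE] := normal_class (sBB (proj2_sig i)) (g i); exists I.
  exists 0; split=> //; last by rewrite h0 /LPic_class !raddf0.
  by split; rewrite ?oppr0; exact: sBP.
pose I i := projT1 (cid (ex i)).
have IP i : [/\ normal (I i), g i = LPic_class (@sCB (proj1_sig i)) (I i) &
    g i = 0 -> I i = 0] by exact: projT2 (cid (ex i)).
pose dvd d i := ((I i : set L) (phi d) /\
  ((- I i : invideal (BB (proj1_sig i))) : set L) (phi d)).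
have dvdM d e i : d \in D -> dvd e i -> dvd (d * e) i.
  move=> dD [Ie NIe].
  have dB : phi d \in BB (proj1_sig i) by exact: sBB (proj2_sig i) _ (constant_mem dD).
  by split; rewrite rmorphM; [have [_ IM] := invideal_submodule (I i)|
    have [_ IM] := invideal_submodule (- I i)]; exact: IM.
(* Constants for the finitely many [i] in the support are multiplied together; elsewhere [I i] is
   the whole ring and contains every constant of [D]. *)
have [d [dD d0 dI]] : exists d, [/\ d \in D, d != 0 & forall i, dvd d i].
  have /asboolP/(@finite_seqP {classic index})[s sE] := valP h.
  have [d [dD d0 ds]] : exists d, [/\ d \in D, d != 0 &
      forall i : {classic index}, i \in s -> dvd d i].
    elim: s {sE} => [|i s [d [dD d0 ds]]]; first by exists 1; rewrite rpred1 oner_neq0.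
    have [nI _ _] := IP i.
    have [e [eD e0 Ie NIe]] := normal_const2 (sBB (proj2_sig i)) nI.
    exists (d * e); split; [exact: rpredM|exact: mulf_neq0|].
    move=> j; rewrite inE => /orP[/eqP->|/ds dj]; first exact: dvdM.
    by rewrite mulrC; exact: dvdM.
  exists d; split=> // i; have [hi0|hi0] := pselect (g i = 0); last first.
    by apply: ds; suff: [set` s] i by []; rewrite -sE.
  have [_ _ /(_ hi0) I0] := IP i; rewrite /dvd I0 oppr0.
  by split; apply: sBB (proj2_sig i) _ (constant_mem dD).
pose NI i : invideal (BB (proj1_sig i)) := - I i.
pose M := glued (fun i => I i); pose N := glued (fun i => NI i).
have MB : submodule (BB D) M by apply: glued_submodule => i; exact: invideal_submodule.
have NB : submodule (BB D) N by apply: glued_submodule => i; exact: invideal_submodule.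
have locM i y : (I i : set L) y -> spanning D (proj1_sig i) (residual phi D M y).
  move=> Iy; apply: (spanning_glued _ dD d0) => //.
  - by move=> j; exact: invideal_submodule.
  - by move=> j; case: (dI j).
  - by have [[IiP _] _ _] := IP i; exact: IiP.
have locN i y : (NI i : set L) y -> spanning D (proj1_sig i) (residual phi D N y).
  move=> Iy; apply: (spanning_glued _ dD d0) => //.
  - by move=> j; exact: invideal_submodule.
  - by move=> j; case: (dI j).
  - by have [[_ IiP] _ _] := IP i; exact: IiP.
have MN1 : mulset M N 1.
  apply: (glue_one jaffard).
  - exact: submodule_sub (@sCB D) MB.
  - exact: submodule_sub (@sCB D) NB.
  move=> T TT; pose i : index := exist _ T TT.
  have : mulset (I i) (NI i) 1 by rewrite mulset_invidealN; exact: rpred1.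
  by apply: mulset_mono => y; [exact: locM|exact: locN].
(* Each product lies in [I i] times its inverse, which is [BB T]; these rings meet in [BB D] among
   the polynomials. *)
have MNB : mulset M N = [set` BB D].
  apply/seteqP; split.
    apply: mulset_sub; first by have [] := subring_submodule (BB D).
    move=> y z [yP My] [zP Nz]; apply: BBcap; first exact: PM.
    move=> T TT; pose i : index := exist _ T TT.
    have : mulset (I i) (NI i) (y * z) by exact: mulset_mem.
    by rewrite mulset_invidealN.
  move=> b bB; rewrite -[b]mulr1; have [_] : submodule (BB D) (mulset M N).
    exact: submodule_mulset.
  exact.
have Md : M (phi d) by split=> // i; case: (dI i).
have Nd : N (phi d) by split=> // i; case: (dI i).
have Mfrac : fractional (BB D) M.
  split=> //; exists (phi d); split; [exact: constant_mem|exact: phi_neq0|].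
  move=> y My; suff : [set` BB D] (phi d * y) by [].
  by rewrite -MNB mulrC; exact: mulset_mem.
have Nfrac : fractional (BB D) N.
  split=> //; exists (phi d); split; [exact: constant_mem|exact: phi_neq0|].
  move=> y Ny; suff : [set` BB D] (phi d * y) by [].
  by rewrite -MNB; exact: mulset_mem.
have Minv : invertible (BB D) M by split=> //; exists N.
exists (LPic_class (@sCB D) (invideal_of Minv)).
apply: val_inj; apply: functional_extensionality_dep => i.
rewrite [LHS]local_classesE; have [_ gE _] := IP i.
rewrite [RHS]gE; congr LPic_class.
have [[I0 ID] IM] := invideal_submodule (I i).
(* The inclusion of [I i] in the extension of [M] is [locM], with the extension read as a
   localization. *)
apply/val_inj/seteqP; split.
  apply: mulset_sub => // y b [_ /(_ i) Iy] bB.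
  by rewrite mulrC; exact: IM.
by move=> y /locM; exact: (ext_residual _ (proj2_sig i) MB).2.
Qed.

Theorem LPic_decomposition : group_isomorphic (LPic (@sCB D))
  (direct_sum (fun i : index => LPic (@sCB (proj1_sig i)))).
Proof.
exists local_sum; exists (fun h => projT1 (cid (local_sum_surjective h))).
  by move=> c; apply: local_sum_injective; case: cid.
by move=> h; case: cid.
Qed.

End Decomposition.

(** * Rational functions *)

Section RationalFunctions.
Variables (K : fieldType) (x : K).
Local Notation L := {fraction {poly K}}.
Local Notation phi := (@tofrac {poly K} \o polyC).
Implicit Types (A : subringClosed K) (f : {poly K}).

Definition polynomials : set L := range (@tofrac {poly K}).

Lemma polynomials_addclosed : addclosed polynomials.
Proof.
split; first by exists 0; rewrite ?rmorph0.
by move=> _ _ [f _ <-] [g _ <-]; exists (f + g); rewrite ?rmorphD.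
Qed.

Lemma polynomialsM y z : polynomials y -> polynomials z -> polynomials (y * z).
Proof. by move=> [f _ <-] [g _ <-]; exists (f * g); rewrite ?rmorphM. Qed.

Lemma mem_bhargava_in A f : (tofrac f \in bhargava_in A x) = (f \in bhargava A x).
Proof.
apply/asboolP/idP => [[g gB /eqP]|fB]; last by exists f.
by rewrite tofrac_eq => /eqP <-.
Qed.

Lemma bhargava_in_polynomials A y : y \in bhargava_in A x -> polynomials y.
Proof. by move=> /asboolP[f _ <-]; exists f. Qed.

Lemma polynomials_clear A y : is_quotient_field A -> x \in A -> polynomials y ->
  exists d, [/\ d \in A, d != 0 & phi d * y \in bhargava_in A x].
Proof.
move=> quoA xA [f _ <-]; have [d [dA d0 dfA]] := clear_denominators f quoA.
exists d; split=> //; rewrite [phi d]/= -rmorphM mem_bhargava_in mul_polyC.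
exact: polyOver_bhargava.
Qed.

(** Euclidean division: a nonzero element of least degree divides all others, as remainders stay in
    [N]. *)
Lemma polynomial_ideal_generator (N : set L) :
  addclosed N -> (forall p z, polynomials p -> N z -> N (p * z)) ->
  N `<=` polynomials -> (exists2 z, N z & z != 0) ->
  exists g, [/\ N g, g != 0 & forall z, N z -> polynomials (z / g)].
Proof.
move=> [N0 ND] NM Npoly [z0 Nz0 z0_neq0].
have [f0 _ f0E] := Npoly z0 Nz0.
pose P n := `[< exists f, [/\ N (tofrac f), f != 0 & size f = n] >].
have exP : exists n, P n.
  exists (size f0); apply/asboolP; exists f0; split=> //; first by rewrite f0E.
  by rewrite -tofrac_eq0 f0E.
case: (ex_minnP exP) => n /asboolP[g [Ng g0 gn]] gmin.
exists (tofrac g); split; [exact: Ng|by rewrite tofrac_eq0|].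
move=> z Nz; have [h _ hE] := Npoly z Nz.
have r0 : h %% g = 0.
  apply/eqP; apply: contraT => r_neq0.
  have : P (size (h %% g)).
    apply/asboolP; exists (h %% g); split=> //.
    have -> : h %% g = h + (- (h %/ g)) * g.
      by rewrite {2}(divp_eq h g) mulNr addrC addKr.
    by rewrite tofracD tofracM hE; apply: ND => //; apply: NM => //; exists (- (h %/ g)).
  by move=> /gmin; rewrite -gn leqNgt ltn_modp g0.
have -> : z = tofrac (h %/ g) * tofrac g.
  by rewrite -hE {1}(divp_eq h g) r0 addr0 tofracM.
by rewrite mulfK; [exists (h %/ g)|rewrite tofrac_eq0].
Qed.

(** The units of [K[X]] have degree [0]. *)
Lemma polynomials_unit y : y != 0 -> polynomials y -> polynomials y^-1 ->
  exists c, y = phi c.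
Proof.
move=> y0 [f _ fE] [g _ gE].
have fg : f * g = 1.
  by apply/eqP; rewrite -tofrac_eq tofracM fE gE mulfV// tofrac1.
have : size (f * g) == 1 by rewrite fg size_poly1.
rewrite size_mul_eq1 => /andP[/size_poly1P[c _ fc] _].
by exists c; rewrite -fE fc.
Qed.

Lemma polyC_bhargava A c : 0 \in A -> c%:P \in bhargava A x -> c \in A.
Proof. by move=> A0 /bhargavaP/(_ 0 A0); rewrite comp_polyC polyOverC. Qed.

End RationalFunctions.

Theorem corollary7p9 (K : fieldType) (D : subringClosed K)
  (hK : is_quotient_field D) (hD : [set` D] != setT)
  (x : K) (hx : x \in D)
  (Theta : set (subringClosed K)) (hTheta : jaffard_family D Theta) :
  group_isomorphic (LPic_bhargava D x)
    (direct_sum (fun T : {T : subringClosed K | Theta T} =>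
       LPic_bhargava (proj1_sig T) x)).
Proof.
have polyK c : polynomials ((@tofrac {poly K} \o polyC) c) by exists c%:P.
apply: (@LPic_decomposition K _ (@tofrac {poly K} \o polyC) D Theta hK hTheta
  (@polynomials K) (fun A => bhargava_in A x) (@polynomials_addclosed K)
  (@polynomialsM K) polyK (@polynomial_ideal_generator K) (@polynomials_unit K)
  (fun A => @const_bhargava K A x)).
- by move=> A y; exact: bhargava_in_polynomials.
- move=> T TT _ /asboolP[f fB <-]; rewrite mem_bhargava_in.
  exact: (bhargava_sub hK hTheta hx TT).
- move=> _ [f _ <-] fT; rewrite mem_bhargava_in.
  by apply: (bhargava_bigcap hTheta) => T /fT; rewrite mem_bhargava_in.
- move=> c; rewrite /= mem_bhargava_in; exact: polyC_bhargava (rpred0 D).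
- by move=> y; exact: polynomials_clear.
- move=> T _ TT /asboolP[f fT <-].
  (* Inside [K(X)], the residual of [f] is the ideal of all [c] in [D] with [c f] in the Bhargava
     ring of [D]. *)
  have := spanning_bhargava hK hTheta hx TT fT.
  apply: spanning_sup.
    apply: residual_ideal; apply: submodule_sub (subring_submodule _).
    exact: const_bhargava.
  move=> c [cD cf]; split=> //=; rewrite -tofracM mem_bhargava_in mul_polyC.
  exact: cf.
Qed.
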